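(* Let $\mathbf{L}\in Q^2(\mathbb{D}^2)$. An analytic function $F\colon\mathbb{D}^2\to\mathbb{C}$ has bounded $\mathbf{L}$-index in joint variables if and only if there exist $p\in\mathbb{Z}_+$ and $c\in\mathbb{R}_+$ such that for each $z\in\mathbb{D}^2$ $$\max\left\{\frac{|F^{(j_1,j_2)}(z)|}{l_1^{j_1}(z)l_2^{j_2}(z)}: j_1+j_2=p+1\right\}\le c\max\left\{\frac{|F^{(k_1,k_2)}(z)|}{l_1^{k_1}(z)l_2^{k_2}(z)}: k_1+k_2\le p\right\}.$$
   Context: $\mathbb{D}^2=\{(z_1,z_2)\in\mathbb{C}^2:|z_1|<1,|z_2|<1\}$, $\mathbb{Z}_+=\{0,1,2,\dots\}$, $\mathbb{R}_+=[0,\infty)$. A constant $\beta>1$ is fixed. $\mathbf{L}(z)=(l_1(z),l_2(z))$, where each $l_j\colon\mathbb{D}^2\to\mathbb{R}_+$ is continuous and satisfies $l_j(z_1,z_2)>\beta/(1-|z_j|)$ for all $(z_1,z_2)\in\mathbb{D}^2$, $j=1,2$. For $z^0\in\mathbb{C}^2$ and $R=(r_1,r_2)\in\mathbb{R}_+^2$: $\mathbb{D}^2[z^0,R]=\{z:|z_j-z_j^0|\le r_j,\ j=1,2\}$ and $\frac{R}{\mathbf{L}(z^0)}=\big(\frac{r_1}{l_1(z^0)},\frac{r_2}{l_2(z^0)}\big)$. $F^{(p,q)}=\frac{\partial^{p+q}F}{\partial z_1^p\partial z_2^q}$. An analytic $F\colon\mathbb{D}^2\to\mathbb{C}$ has bounded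 $\mathbf{L}$-index in joint variables if there is $n_0\in\mathbb{Z}_+$ such that for all $z\in\mathbb{D}^2$ and all $(p_1,p_2)\in\mathbb{Z}_+^2$: $\frac{|F^{(p_1,p_2)}(z)|}{p_1!p_2!\,l_1^{p_1}(z)l_2^{p_2}(z)}\le\max\{\frac{|F^{(k_1,k_2)}(z)|}{k_1!k_2!\,l_1^{k_1}(z)l_2^{k_2}(z)}:0\le k_1+k_2\le n_0\}$. $Q^2(\mathbb{D}^2)$ is the class of such $\mathbf{L}$ for which, for all $R=(r_1,r_2)\in[0,\beta]^2$ and $j=1,2$, $0<\lambda_{1,j}(R)\le\lambda_{2,j}(R)<\infty$, where $\lambda_{1,j}(R)=\inf_{z^0\in\mathbb{D}^2}\inf\{l_j(z)/l_j(z^0): z\in\mathbb{D}^2[z^0,R/\mathbf{L}(z^0)]\}$ and $\lambda_{2,j}(R)=\sup_{z^0\in\mathbb{D}^2}\sup\{l_j(z)/l_j(z^0): z\in\mathbb{D}^2[z^0,R/\mathbf{L}(z^0)]\}$. *)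

(* Defs.v *)
(* concrete reals R, Coquelicot complex numbers C
   (C_NormedModule is a normed module over the absolute-value ring C_AbsRing,
   so Coquelicot's generic [is_derive] over C_AbsRing is the complex derivative). *)
From Stdlib Require Import Reals List ClassicalEpsilon Factorial.
From Coquelicot Require Import Coquelicot.
Open Scope R_scope.

Definition in_D2 (z : C * C) : Prop := Cmod (fst z) < 1 /\ Cmod (snd z) < 1.

(* complex derivative of a function C -> C (chosen by description; it is the
   unique complex derivative whenever it exists) *)
Definition cderiv (f : C -> C) (x : C) : C :=
  epsilon (inhabits (RtoC 0))
    (fun l : C => @is_derive C_AbsRing C_NormedModule f x l).

Definition pd1 (F : C * C -> C) (z : C * C) : C :=
  cderiv (fun w => F (w, snd z)) (fst z).
Definition pd2 (F : C * C -> C) (z : C * C) : C :=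
  cderiv (fun w => F (fst z, w)) (snd z).

Definition pderiv (F : C * C -> C) (p q : nat) : C * C -> C :=
  Nat.iter p pd1 (Nat.iter q pd2 F).

Definition analytic_D2 (F : C * C -> C) : Prop :=
  forall z0, in_D2 z0 ->
  exists r, 0 < r /\ exists a : nat -> nat -> C,
    forall z, in_D2 z ->
      Cmod (Cminus (fst z) (fst z0)) < r -> Cmod (Cminus (snd z) (snd z0)) < r ->
      (exists M : R, forall N : nat,
          sum_n (fun m => sum_n (fun n =>
             Cmod (a m n) * Cmod (Cminus (fst z) (fst z0)) ^ m * Cmod (Cminus (snd z) (snd z0)) ^ n) N) N
          <= M) /\
      filterlim
        (fun N : nat => sum_n (fun m => sum_n (fun n =>
             Cmult (Cmult (a m n) (@pow_n C_Ring (Cminus (fst z) (fst z0)) m))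
                   (@pow_n C_Ring (Cminus (snd z) (snd z0)) n)) N) N)
        eventually (locally (F z)).

(* max { g j1 j2 : j1 + j2 = s }  (all values considered are >= 0) *)
Definition max_eq (s : nat) (g : nat -> nat -> R) : R :=
  fold_right Rmax 0 (map (fun j => g j (s - j)%nat) (List.seq 0 (S s))).

Definition max_le (n : nat) (g : nat -> nat -> R) : R :=
  fold_right Rmax 0 (map (fun s => max_eq s g) (List.seq 0 (S n))).

Definition idx_term (F : C * C -> C) (l1 l2 : C * C -> R) (z : C * C)
  (k1 k2 : nat) : R :=
  Cmod (pderiv F k1 k2 z) /
    (INR (Factorial.fact k1) * INR (Factorial.fact k2) * l1 z ^ k1 * l2 z ^ k2).

Definition bounded_L_index (F : C * C -> C) (l1 l2 : C * C -> R) : Prop :=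
  exists n0 : nat, forall z, in_D2 z -> forall p1 p2 : nat,
    idx_term F l1 l2 z p1 p2 <= max_le n0 (idx_term F l1 l2 z).

Definition admissible_L (beta : R) (l1 l2 : C * C -> R) : Prop :=
  (forall z, in_D2 z -> continuous l1 z /\ continuous l2 z) /\
  (forall z, in_D2 z -> l1 z > beta / (1 - Cmod (fst z)) /\
                        l2 z > beta / (1 - Cmod (snd z))).

Definition in_polydisc (l1 l2 : C * C -> R) (r1 r2 : R) (z0 z : C * C) : Prop :=
  Cmod (Cminus (fst z) (fst z0)) <= r1 / l1 z0 /\ Cmod (Cminus (snd z) (snd z0)) <= r2 / l2 z0.

(* 0 < lambda_{1,j}(R) <= lambda_{2,j}(R) < oo for lj *)
Definition lambda_ok (l1 l2 lj : C * C -> R) (r1 r2 : R) : Prop :=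
  (exists c, 0 < c /\ forall z0 z, in_D2 z0 -> in_D2 z ->
      in_polydisc l1 l2 r1 r2 z0 z -> c <= lj z / lj z0) /\
  (exists M, forall z0 z, in_D2 z0 -> in_D2 z ->
      in_polydisc l1 l2 r1 r2 z0 z -> lj z / lj z0 <= M).

Definition in_Q2 (beta : R) (l1 l2 : C * C -> R) : Prop :=
  forall r1 r2, 0 <= r1 <= beta -> 0 <= r2 <= beta ->
    lambda_ok l1 l2 l1 r1 r2 /\ lambda_ok l1 l2 l2 r1 r2.

Definition nf_term (F : C * C -> C) (l1 l2 : C * C -> R) (z : C * C)
  (j1 j2 : nat) : R :=
  Cmod (pderiv F j1 j2 z) / (l1 z ^ j1 * l2 z ^ j2).

(* Main.v *)
(** Sufficiency is a Gronwall argument.  On the polydisc of radii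
    [beta / l_j(z0)] the functions [l_j] are comparable to their values at [z0],
    so the hypothesis bounds all derivatives of order [p + 1] by those of order
    at most [p], uniformly after freezing the weights at [z0].  Hence the energy
    [sum_(j + k <= p) (|F^(j,k)| / (l1(z0)^j l2(z0)^k))^2] grows by at most a
    constant factor along the two axis-parallel segments joining [z0] to a point
    of the polydisc, and this bounds [|F|] there.  Cauchy's estimates then give
    [|F^(j,k)(z0)| / (j! k! l1^j l2^k) <= C beta^-(j+k) M], where [M] is the
    largest such quotient of order at most [p]; since [beta > 1], the right-hand
    side is at most [M] for high orders. *)
Require Import Defs.
From Stdlib Require Import Reals List ClassicalEpsilon Factorial Lra Lia.
From Coquelicot Require Import Coquelicot.
Open Scope R_scope.

(** * Complex derivatives *)

(** The weights [l1] and [l2] are only continuous, so quotients with running weights cannot be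
    differentiated along a segment: hence the freezing. A maximum of moduli is not differentiable
    either: hence a sum of squares as energy. The lower bound on [l_j] places the closed polydisc of
    radii [beta / l_j(z0)] inside the bidisc, and these radii cancel the weights in Cauchy's
    estimates. All constants depend on [p], [c], [beta] and the comparison ratio, not on [z0], so
    one [n0] serves every point. Necessity is algebraic: an index bound by [n0] controls the
    derivatives of order [n0 + 1], and the two normalisations differ by bounded factorials. The
    analytic tools rest on the power series: term-by-term differentiation identifies [pderiv] with
    the differentiated expansion, and Cauchy's estimates come from real integrals over circles, by
    integration by parts and the mean value property. *)

Definition cder (f : C -> C) (x l : C) : Prop :=
  forall eps, 0 < eps -> exists del, 0 < del /\ forall h : C, Cmod h < del ->
    Cmod (f (x + h) - f x - h * l)%C <= eps * Cmod h.

Lemma Cplus_minus_cancel (x y : C) : (x + (y - x))%C = y.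
Proof. ring. Qed.

(** The bridge to [cderiv]: every estimate on complex derivatives below is made in the increment
    form. *)
Lemma cder_is_derive (f : C -> C) (x l : C) :
  cder f x l <-> @is_derive C_AbsRing C_NormedModule f x l.
Proof.
split.
- intros H; split; [apply is_linear_scal_l|].
  intros y Hy eps.
  rewrite <- (is_filter_lim_locally_unique _ _ Hy); clear y Hy.
  destruct (H eps (cond_pos eps)) as [del [Hdel Hd]].
  exists (mkposreal del Hdel); intros y Hy.
  change (Cmod (y - x)%C < del) in Hy.
  change (Cmod (f y - f x - (y - x) * l)%C <= eps * Cmod (y - x)%C).
  specialize (Hd (y - x)%C Hy).
  now rewrite Cplus_minus_cancel in Hd.
- intros [_ H] eps Heps.
  specialize (H x (fun P HP => HP) (mkposreal eps Heps)).
  destruct H as [del Hd].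
  exists del; split; [apply cond_pos|]; intros h Hh.
  assert (Hx : (x + h - x = h)%C) by ring.
  specialize (Hd (x + h)%C).
  change (Cmod (x + h - x)%C < del ->
    Cmod (f (x + h) - f x - (x + h - x) * l)%C <= eps * Cmod (x + h - x)%C) in Hd.
  rewrite Hx in Hd; now apply Hd.
Qed.

Lemma cder_unique (f : C -> C) (x l1 l2 : C) : cder f x l1 -> cder f x l2 -> l1 = l2.
Proof.
intros H1 H2.
assert (E : Cmod (l1 - l2)%C = 0).
{ destruct (Rle_lt_or_eq_dec _ _ (Cmod_ge_0 (l1 - l2)%C)) as [Hp|He]; [exfalso|easy].
  set (e := Cmod (l1 - l2)%C) in *.
  (* Two errors of [e / 4] add up to half of [e], a contradiction at any nonzero increment. *)
  destruct (H1 (e / 4) ltac:(lra)) as [d1 [Hd1 K1]].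
  destruct (H2 (e / 4) ltac:(lra)) as [d2 [Hd2 K2]].
  pose proof (Rmin_pos _ _ Hd1 Hd2) as Hm.
  set (d := Rmin d1 d2) in *.
  assert (Hh : Cmod (RtoC (d / 2)) = d / 2) by (rewrite Cmod_R, Rabs_pos_eq; lra).
  specialize (K1 (RtoC (d / 2))); specialize (K2 (RtoC (d / 2))).
  rewrite Hh in K1, K2.
  specialize (K1 ltac:(unfold d in *; pose proof (Rmin_l d1 d2); lra)).
  specialize (K2 ltac:(unfold d in *; pose proof (Rmin_r d1 d2); lra)).
  assert (T : Cmod (RtoC (d / 2) * (l1 - l2))%C <= e / 4 * (d / 2) + e / 4 * (d / 2)).
  { replace (RtoC (d / 2) * (l1 - l2))%C with
      ((f (x + RtoC (d/2)) - f x - RtoC (d/2) * l2)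
       - (f (x + RtoC (d/2)) - f x - RtoC (d/2) * l1))%C
      by ring.
    unfold Cminus at 1. eapply Rle_trans; [apply Cmod_triangle|].
    rewrite Cmod_opp; lra. }
  rewrite Cmod_mult, Hh in T; fold e in T. nra. }
apply Cmod_eq_0 in E.
replace l1 with (l1 - l2 + l2)%C by ring; rewrite E; ring.
Qed.

Lemma cderiv_eq (f : C -> C) (x l : C) : cder f x l -> cderiv f x = l.
Proof.
intros H; apply (cder_unique f x); [|easy].
apply cder_is_derive; unfold cderiv; apply epsilon_spec.
exists l; now apply cder_is_derive.
Qed.

Lemma cder_ext_loc (f g : C -> C) (x l : C) (r : R) :
  0 < r -> (forall y, Cmod (y - x)%C < r -> f y = g y) -> cder f x l -> cder g x l.
Proof.
intros Hr E H eps Heps.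
destruct (H eps Heps) as [d [Hd K]].
exists (Rmin d r); split; [now apply Rmin_pos|]; intros h Hh.
pose proof (Rmin_l d r); pose proof (Rmin_r d r).
rewrite <- !E; [apply K; lra| |].
- replace (x - x)%C with (RtoC 0) by ring; rewrite Cmod_0; lra.
- replace (x + h - x)%C with h by ring; lra.
Qed.

(** Made for term-by-term differentiation: quadratic remainder bounds can be summed over a
    series. *)
Lemma cder_quad (f : C -> C) (x l : C) (r K : R) :
  0 < r -> (forall h, Cmod h < r -> Cmod (f (x + h) - f x - h * l)%C <= K * Cmod h ^ 2) ->
  cder f x l.
Proof.
intros Hr H eps Heps.
pose proof (Rabs_pos K) as HK.
assert (Hq : 0 < eps / (Rabs K + 1)) by (apply Rdiv_lt_0_compat; lra).
exists (Rmin r (eps / (Rabs K + 1))); split; [now apply Rmin_pos|]; intros h Hh.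
pose proof (Rmin_l r (eps / (Rabs K + 1))); pose proof (Rmin_r r (eps / (Rabs K + 1))).
eapply Rle_trans; [apply H; lra|].
pose proof (Cmod_ge_0 h); pose proof (Rle_abs K).
assert (Cmod h * (Rabs K + 1) <= eps).
{ apply (Rmult_le_reg_r (/ (Rabs K + 1))); [apply Rinv_0_lt_compat; lra|].
  rewrite Rmult_assoc, Rinv_r, Rmult_1_r by lra. unfold Rdiv in *; lra. }
assert (K * Cmod h <= eps) by nra.
replace (K * Cmod h ^ 2) with (K * Cmod h * Cmod h) by ring.
now apply Rmult_le_compat_r.
Qed.

(** * Double series summed over squares *)

(** The partial sums of [analytic_D2], over any monoid so that complex series and their real
    majorants share them. *)
Definition dsq {G : AbelianMonoid} (u : nat -> nat -> G) (N : nat) : G :=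
  sum_n (fun m => sum_n (u m) N) N.

(** The next square adds an L-shaped shell: one new entry in each old row, then the new row. *)
Lemma dsq_S {G : AbelianMonoid} (u : nat -> nat -> G) (N : nat) :
  dsq u (S N) = plus (dsq u N)
    (plus (sum_n (fun m => u m (S N)) N) (sum_n (u (S N)) (S N))).
Proof.
unfold dsq at 1; rewrite sum_Sn, plus_assoc; f_equal.
rewrite (sum_n_ext _ (fun m => plus (sum_n (u m) N) (u m (S N))))
  by (intros; apply sum_Sn).
now rewrite sum_n_plus.
Qed.

Lemma Cmod_sum_n_le (u : nat -> C) (v : nat -> R) (N : nat) :
  (forall n, Cmod (u n) <= v n) ->
  Cmod (sum_n (G := C_AbelianMonoid) u N) <= sum_n (G := R_AbelianMonoid) v N.
Proof.
intros H; induction N as [|N IH]; [rewrite !sum_O; apply H|].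
rewrite !sum_Sn. eapply Rle_trans; [apply Cmod_triangle|].
apply Rplus_le_compat; [apply IH|apply H].
Qed.

Lemma Cmod_dsq_le (u : nat -> nat -> C) (v : nat -> nat -> R) (N : nat) :
  (forall m n, Cmod (u m n) <= v m n) ->
  Cmod (dsq (G := C_AbelianMonoid) u N) <= dsq (G := R_AbelianMonoid) v N.
Proof.
intros H; apply Cmod_sum_n_le; intros m; apply Cmod_sum_n_le; intros n; apply H.
Qed.

Lemma dsq_le (u v : nat -> nat -> R) (N : nat) :
  (forall m n, u m n <= v m n) ->
  dsq (G := R_AbelianMonoid) u N <= dsq (G := R_AbelianMonoid) v N.
Proof. intros H; unfold dsq; apply sum_n_m_le; intros m; apply sum_n_m_le; auto. Qed.

Lemma dsq_scal (k : R) (u : nat -> nat -> R) (N : nat) :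
  dsq (G := R_AbelianMonoid) (fun m n => k * u m n) N = k * dsq (G := R_AbelianMonoid) u N.
Proof.
unfold dsq.
rewrite (sum_n_ext _ (fun m => mult (K := R_Ring) k (sum_n (u m) N))).
- apply (sum_n_mult_l (K := R_Ring)).
- intros m; apply (sum_n_mult_l (K := R_Ring) k (u m)).
Qed.

Definition is_dsum (u : nat -> nat -> C) (l : C) : Prop :=
  filterlim (dsq (G := C_AbelianMonoid) u) eventually (locally l).

Lemma is_dsum_eps (u : nat -> nat -> C) (l : C) :
  is_dsum u l <->
  forall eps, 0 < eps -> exists N0, forall N, (N0 <= N)%nat ->
    Cmod (dsq (G := C_AbelianMonoid) u N - l)%C < eps.
Proof.
split.
- intros H eps Heps.
  (* Balls of [C] are products of real balls, so the one of radius [eps / sqrt 2] lies in the disc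
     of radius [eps]. *)
  assert (Hs : 0 < sqrt 2) by (apply sqrt_lt_R0; lra).
  assert (He : 0 < eps / sqrt 2) by (apply Rdiv_lt_0_compat; lra).
  destruct (proj1 (filterlim_locally _ _) H (mkposreal _ He)) as [N0 HN].
  exists N0; intros N HN'.
  pose proof (C_NormedModule_mixin_compat2 _ _ _ (HN N HN')) as K.
  simpl in K. replace (sqrt 2 * (eps / sqrt 2)) with eps in K by (field; lra).
  exact K.
- intros H; apply filterlim_locally; intros eps.
  destruct (H eps (cond_pos eps)) as [N0 HN].
  exists N0; intros N HN'.
  apply C_NormedModule_mixin_compat1. exact (HN N HN').
Qed.

Lemma is_dsum_unique (u : nat -> nat -> C) (l l' : C) : is_dsum u l -> is_dsum u l' -> l = l'.
Proof.
intros H H'.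
exact (filterlim_locally_unique (K := C_AbsRing) (V := C_NormedModule) _ _ _ H H').
Qed.

Lemma is_dsum_ext (u v : nat -> nat -> C) (l : C) :
  (forall m n, u m n = v m n) -> is_dsum u l -> is_dsum v l.
Proof.
intros E; apply filterlim_ext; intros N.
apply sum_n_ext; intros m; apply sum_n_ext; intros n; apply E.
Qed.

Lemma is_dsum_swap (u : nat -> nat -> C) (l : C) :
  is_dsum u l -> is_dsum (fun m n => u n m) l.
Proof.
apply filterlim_ext; intros N; unfold dsq; apply (sum_n_switch u).
Qed.

Lemma is_dsum_plus (u v : nat -> nat -> C) (a b : C) :
  is_dsum u a -> is_dsum v b -> is_dsum (fun m n => u m n + v m n)%C (a + b)%C.
Proof.
intros Hu Hv.
apply (filterlim_ext (fun N =>
  plus (dsq (G := C_AbelianMonoid) u N) (dsq (G := C_AbelianMonoid) v N))).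
- intros N; unfold dsq; rewrite <- sum_n_plus.
  apply sum_n_ext; intros m; now rewrite <- sum_n_plus.
- eapply filterlim_comp_2; [exact Hu|exact Hv|].
  exact (filterlim_plus (K := C_AbsRing) (V := C_NormedModule) a b).
Qed.

Lemma is_dsum_scal (k : C) (u : nat -> nat -> C) (a : C) :
  is_dsum u a -> is_dsum (fun m n => k * u m n)%C (k * a)%C.
Proof.
intros Hu.
apply (filterlim_ext (fun N => scal k (dsq (G := C_AbelianMonoid) u N : C_NormedModule))).
- intros N; unfold dsq.
  rewrite (sum_n_ext (fun m => sum_n (fun n => (k * u m n)%C) N)
    (fun m => mult (K := C_Ring) k (sum_n (u m) N))).
  + symmetry; apply (sum_n_mult_l (K := C_Ring)).
  + intros m; apply (sum_n_mult_l (K := C_Ring) k (u m)).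
- eapply filterlim_comp; [exact Hu|].
  exact (filterlim_scal_r (K := C_AbsRing) (V := C_NormedModule) k a).
Qed.

Lemma is_dsum_bound (u : nat -> nat -> C) (l : C) (M : R) :
  (forall N, Cmod (dsq (G := C_AbelianMonoid) u N) <= M) -> is_dsum u l -> Cmod l <= M.
Proof.
intros HM H; rewrite is_dsum_eps in H.
apply Rnot_lt_le; intros Hl.
destruct (H (Cmod l - M) ltac:(lra)) as [N0 HN].
specialize (HN N0 (le_n _)); specialize (HM N0).
set (T := dsq u N0) in *.
assert (Cmod l <= Cmod T + Cmod (T - l)%C); [|lra].
replace l with (T + - (T - l))%C at 1 by ring.
eapply Rle_trans; [apply Cmod_triangle|]. rewrite Cmod_opp; lra.
Qed.

(** The shells of [dsq_S] turn the double series into a simple one. They are bounded by the shells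
    of [v], whose partial sums increase and stay below [M], so completeness of [C] gives the
    limit. *)
Lemma ex_dsum (u : nat -> nat -> C) (v : nat -> nat -> R) (M : R) :
  (forall m n, Cmod (u m n) <= v m n) ->
  (forall N, dsq (G := R_AbelianMonoid) v N <= M) -> exists l, is_dsum u l.
Proof.
intros Huv HM.
set (d := fun N => match N with O => dsq (G := C_AbelianMonoid) u O
  | S N => plus (sum_n (fun m => u m (S N)) N) (sum_n (u (S N)) (S N)) end).
set (e := fun N => match N with O => dsq (G := R_AbelianMonoid) v O
  | S N => plus (sum_n (fun m => v m (S N)) N) (sum_n (v (S N)) (S N)) end).
assert (Ed : forall N, sum_n (G := C_AbelianMonoid) d N = dsq (G := C_AbelianMonoid) u N).
{ induction N as [|N IH]; [now rewrite sum_O|]. now rewrite sum_Sn, dsq_S, IH. }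
assert (Ee : forall N, sum_n (G := R_AbelianMonoid) e N = dsq (G := R_AbelianMonoid) v N).
{ induction N as [|N IH]; [now rewrite sum_O|]. now rewrite sum_Sn, dsq_S, IH. }
assert (Hde : forall N, Cmod (d N) <= e N).
{ intros [|N]; [now apply Cmod_dsq_le|].
  eapply Rle_trans; [apply Cmod_triangle|].
  apply Rplus_le_compat; apply Cmod_sum_n_le; intros; apply Huv. }
assert (Hs : ex_series (K := C_AbsRing) (V := C_NormedModule) d).
{ apply (ex_series_le (K := C_AbsRing) (V := C_CompleteNormedModule) d e Hde).
  destruct (ex_finite_lim_seq_incr (sum_n (G := R_AbelianMonoid) e) M) as [l Hl].
  - intros N; rewrite sum_Sn. pose proof (Cmod_ge_0 (d (S N))). pose proof (Hde (S N)).
    unfold plus; simpl; simpl in *; lra.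
  - intros N; rewrite Ee; apply HM.
  - now exists l. }
destruct Hs as [l Hl]; exists l.
exact (filterlim_ext _ _ Ed Hl).
Qed.

(** * Derivatives of monomials and their remainders *)

(** A slightly larger radius absorbs the factor that differentiating a power produces. This is
    Bernoulli's inequality for [(1 + d) ^ m] with [d = t' / t - 1]. *)
Lemma lin_geom (t t' : R) : 0 < t < t' ->
  exists K, 0 < K /\ forall m, INR (S m) * t ^ m <= K * t' ^ m.
Proof.
intros Ht.
set (d := t' / t - 1).
assert (Hd : 0 < d).
{ unfold d. apply Rlt_0_minus, (Rmult_lt_reg_r t); [lra|].
  unfold Rdiv; rewrite Rmult_assoc, Rinv_l; lra. }
exists (1 + / d).
assert (Hi : 0 < / d) by now apply Rinv_0_lt_compat.
split; [lra|]; intros m.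
replace (t' ^ m) with ((1 + d) ^ m * t ^ m)
  by (rewrite <- Rpow_mult_distr; f_equal; unfold d; field; lra).
rewrite <- Rmult_assoc; apply Rmult_le_compat_r; [apply pow_le; lra|].
pose proof (poly m d Hd) as B. rewrite S_INR.
pose proof (pos_INR m).
apply Rle_trans with ((1 + / d) * (1 + INR m * d)); [|apply Rmult_le_compat_l; lra].
replace ((1 + / d) * (1 + INR m * d)) with (1 + INR m * d + / d + INR m) by (field; lra).
nra.
Qed.

(** [phi p m x] is the [p]-th derivative of [x ^ m]. *)
Fixpoint phi (p m : nat) (x : C) : C :=
  match p, m with
  | O, _ => (x ^ m)%C
  | S p', O => RtoC 0
  | S p', S m' => (RtoC (INR (S m')) * phi p' m' x)%C
  end.

(** One more derivative costs a factor [INR (S m)], absorbed by [lin_geom] between the midpoint of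
    [t], [t'] and [t']. The division by [t'] in the constant pays for the shift from [m] to
    [S m]. *)
Lemma phi_bound (p : nat) (t t' : R) : 0 < t < t' ->
  exists K, 0 <= K /\ forall m x, Cmod x <= t -> Cmod (phi p m x) <= K * t' ^ m.
Proof.
revert t t'; induction p as [|p IH]; intros t t' Ht.
- exists 1; split; [lra|]; intros m x Hx; simpl.
  rewrite Cmod_pow, Rmult_1_l; apply pow_incr; split; [apply Cmod_ge_0|lra].
- destruct (IH t ((t + t') / 2) ltac:(lra)) as [K [HK H]].
  destruct (lin_geom ((t + t') / 2) t' ltac:(lra)) as [L [HL G]].
  exists (K * L / t'); split.
  { apply Rmult_le_pos; [nra|left; apply Rinv_0_lt_compat; lra]. }
  intros [|m] x Hx.
  { simpl phi; rewrite Cmod_0. apply Rmult_le_pos; [|simpl; lra].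
    apply Rmult_le_pos; [nra|left; apply Rinv_0_lt_compat; lra]. }
  replace (K * L / t' * t' ^ S m) with (K * (L * t' ^ m)) by (simpl; field; lra).
  change (phi (S p) (S m) x) with (RtoC (INR (S m)) * phi p m x)%C.
  rewrite Cmod_mult, Cmod_R, Rabs_pos_eq by apply pos_INR.
  apply Rle_trans with (INR (S m) * (K * ((t + t') / 2) ^ m)).
  + apply Rmult_le_compat_l; [apply pos_INR|now apply H].
  + specialize (G m). pose proof (Rmult_le_compat_l K _ _ HK G). lra.
Qed.

(** If [E] is the remainder of [x ^ m], that of [x ^ S m] is [(x + h) * E + h * h * phi 1 m x], and
    [m ^ 2 + m <= (m + 1) ^ 2] closes the induction. The factor [t ^ 2] on the left replaces
    [t ^ (m - 2)] on the right, where subtraction would truncate. *)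
Lemma pow_quad (t : R) (x h : C) (m : nat) : 0 < t -> Cmod x <= t -> Cmod (x + h)%C <= t ->
  t ^ 2 * Cmod ((x + h) ^ m - x ^ m - h * phi 1 m x)%C <= INR m ^ 2 * Cmod h ^ 2 * t ^ m.
Proof.
intros Ht Hx Hxh; induction m as [|m IH].
- simpl. replace (1 - 1 - h * 0)%C with (RtoC 0) by ring. rewrite Cmod_0. lra.
- set (E := ((x + h) ^ m - x ^ m - h * phi 1 m x)%C) in IH.
  assert (Em : ((x + h) ^ S m - x ^ S m - h * phi 1 (S m) x
     = (x + h) * E + h * h * phi 1 m x)%C).
  { unfold E; destruct m as [|m].
    - simpl; ring_simplify; ring.
    - change (phi 1 (S (S m)) x) with (RtoC (INR (S (S m))) * x ^ S m)%C.
      change (phi 1 (S m) x) with (RtoC (INR (S m)) * x ^ m)%C.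
      rewrite (S_INR (S m)), RtoC_plus. simpl Cpow; ring. }
  rewrite Em.
  assert (Hp : t * Cmod (phi 1 m x) <= INR m * t ^ m).
  { destruct m as [|m]; [simpl; rewrite Cmod_0; lra|].
    change (phi 1 (S m) x) with (RtoC (INR (S m)) * x ^ m)%C.
    rewrite Cmod_mult, Cmod_R, Rabs_pos_eq, Cmod_pow by apply pos_INR.
    assert (Cmod x ^ m <= t ^ m) by (apply pow_incr; split; [apply Cmod_ge_0|easy]).
    pose proof (pos_INR (S m)).
    change (t ^ S m) with (t * t ^ m).
    replace (t * (INR (S m) * Cmod x ^ m)) with (t * INR (S m) * Cmod x ^ m) by ring.
    replace (INR (S m) * (t * t ^ m)) with (t * INR (S m) * t ^ m) by ring.
    apply Rmult_le_compat_l; nra. }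
  apply Rle_trans with (t ^ 2 * (t * Cmod E + Cmod h * Cmod h * Cmod (phi 1 m x))).
  { apply Rmult_le_compat_l; [nra|].
    eapply Rle_trans; [apply Cmod_triangle|]. rewrite !Cmod_mult.
    apply Rplus_le_compat_r, Rmult_le_compat_r; [apply Cmod_ge_0|easy]. }
  rewrite S_INR. change (t ^ S m) with (t * t ^ m).
  pose proof (Cmod_ge_0 h); pose proof (pos_INR m); pose proof (pow_le t m ltac:(lra)).
  apply Rle_trans with (t * (INR m ^ 2 * Cmod h ^ 2 * t ^ m) + t * Cmod h ^ 2 * (INR m * t ^ m)).
  { replace (t ^ 2 * (t * Cmod E + Cmod h * Cmod h * Cmod (phi 1 m x)))
      with (t * (t ^ 2 * Cmod E) + t * Cmod h ^ 2 * (t * Cmod (phi 1 m x))) by ring.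
    apply Rplus_le_compat; apply Rmult_le_compat_l; try easy; nra. }
  replace ((INR m + 1) ^ 2 * Cmod h ^ 2 * (t * t ^ m)) with
    (t * (INR m ^ 2 * Cmod h ^ 2 * t ^ m) + t * Cmod h ^ 2 * (INR m * t ^ m)
     + t * Cmod h ^ 2 * ((INR m + 1) * t ^ m)) by ring.
  assert (0 <= t * Cmod h ^ 2 * ((INR m + 1) * t ^ m)); [|lra].
  repeat apply Rmult_le_pos; try lra; apply pow_le; lra.
Qed.

(** The factor [INR (S m)] comes out of the whole remainder, so the induction is that of
    [phi_bound]. The base case costs [m ^ 2] through [pow_quad], hence two uses of [lin_geom]. *)
Lemma phi_quad (p : nat) (t t' : R) : 0 < t < t' ->
  exists K, 0 <= K /\ forall m x h, Cmod x <= t -> Cmod (x + h)%C <= t ->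
    Cmod (phi p m (x + h) - phi p m x - h * phi (S p) m x)%C <= K * t' ^ m * Cmod h ^ 2.
Proof.
revert t t'; induction p as [|p IH]; intros t t' Ht.
- destruct (lin_geom t ((t + t') / 2) ltac:(lra)) as [K [HK H]].
  destruct (lin_geom ((t + t') / 2) t' ltac:(lra)) as [L [HL G]].
  exists (K * L / t ^ 2); split.
  { apply Rmult_le_pos; [nra|left; apply Rinv_0_lt_compat; nra]. }
  intros m x h Hx Hxh.
  pose proof (pow_quad t x h m ltac:(lra) Hx Hxh) as Q.
  change (phi 0 m (x + h)) with ((x + h) ^ m)%C; change (phi 0 m x) with (x ^ m)%C.
  apply (Rmult_le_reg_l (t ^ 2)); [nra|].
  eapply Rle_trans; [apply Q|].
  replace (t ^ 2 * (K * L / t ^ 2 * t' ^ m * Cmod h ^ 2))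
    with (Cmod h ^ 2 * (K * (L * t' ^ m))) by (field; lra).
  replace (INR m ^ 2 * Cmod h ^ 2 * t ^ m) with (Cmod h ^ 2 * (INR m ^ 2 * t ^ m)) by ring.
  apply Rmult_le_compat_l; [apply pow_le, Cmod_ge_0|].
  specialize (H m); specialize (G m); rewrite S_INR in H, G.
  pose proof (pos_INR m).
  assert (0 <= t ^ m) by (apply pow_le; lra).
  assert (0 <= ((t + t') / 2) ^ m) by (apply pow_le; lra).
  apply Rle_trans with ((INR m + 1) * ((INR m + 1) * t ^ m)); [nra|].
  apply Rle_trans with ((INR m + 1) * (K * ((t + t') / 2) ^ m)).
  { apply Rmult_le_compat_l; lra. }
  pose proof (Rmult_le_compat_l K _ _ (Rlt_le _ _ HK) G). lra.
- destruct (IH t ((t + t') / 2) ltac:(lra)) as [K [HK H]].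
  destruct (lin_geom ((t + t') / 2) t' ltac:(lra)) as [L [HL G]].
  exists (K * L / t').
  assert (HKL : 0 <= K * L / t').
  { apply Rmult_le_pos; [nra|left; apply Rinv_0_lt_compat; lra]. }
  split; [easy|].
  intros [|m] x h Hx Hxh.
  { simpl phi. replace (0 - 0 - h * 0)%C with (RtoC 0) by ring; rewrite Cmod_0.
    apply Rmult_le_pos; [|apply pow_le, Cmod_ge_0].
    apply Rmult_le_pos; [easy|apply pow_le; lra]. }
  change (phi (S p) (S m) ?y) with (RtoC (INR (S m)) * phi p m y)%C.
  change (phi (S (S p)) (S m) x) with (RtoC (INR (S m)) * phi (S p) m x)%C.
  replace (RtoC (INR (S m)) * phi p m (x + h) - RtoC (INR (S m)) * phi p m x -
    h * (RtoC (INR (S m)) * phi (S p) m x))%C with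
    (RtoC (INR (S m)) * (phi p m (x + h) - phi p m x - h * phi (S p) m x))%C by ring.
  replace (K * L / t' * t' ^ S m * Cmod h ^ 2) with (K * (L * t' ^ m) * Cmod h ^ 2)
    by (simpl; field; lra).
  rewrite Cmod_mult, Cmod_R, Rabs_pos_eq by apply pos_INR.
  apply Rle_trans with (INR (S m) * (K * ((t + t') / 2) ^ m * Cmod h ^ 2)).
  + apply Rmult_le_compat_l; [apply pos_INR|now apply H].
  + specialize (G m). pose proof (Rmult_le_compat_l K _ _ HK G).
    replace (INR (S m) * (K * ((t + t') / 2) ^ m * Cmod h ^ 2)) with
      (K * (INR (S m) * ((t + t') / 2) ^ m) * Cmod h ^ 2) by ring.
    apply Rmult_le_compat_r; [apply pow_le, Cmod_ge_0|easy].
Qed.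

(** * Derivatives of analytic functions of two variables *)

(** Quantifying over all smaller radii makes the condition stable under differentiation, where each
    estimate gives up a little radius. *)
Definition dominated (a : nat -> nat -> C) (rho : R) : Prop :=
  forall t, 0 < t < rho -> exists M, forall N,
    dsq (G := R_AbelianMonoid) (fun m n => Cmod (a m n) * t ^ m * t ^ n) N <= M.

Lemma dominated_swap (a : nat -> nat -> C) (rho : R) :
  dominated a rho -> dominated (fun m n => a n m) rho.
Proof.
intros H t Ht; destruct (H t Ht) as [M HM]; exists M; intros N.
eapply Rle_trans; [|apply (HM N)]; right.
unfold dsq; rewrite sum_n_switch.
assert (E : forall x y z : R, x * y * z = x * z * y) by (intros; ring).
apply sum_n_ext; intros m; apply sum_n_ext; intros n; apply E.
Qed.

Definition dsum (u : nat -> nat -> C) : C := epsilon (inhabits (RtoC 0)) (is_dsum u).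

(** The power series of [a] differentiated term by term; its value is meaningful once [dpsum_spec]
    gives convergence. *)
Definition dpsum (a : nat -> nat -> C) (p q : nat) (x y : C) : C :=
  dsum (fun m n => a m n * phi p m x * phi q n y)%C.

Lemma product_bound (t A B K L P Q : R) : 0 <= t -> 0 <= A -> 0 <= B ->
  A <= K * P -> B <= L * Q -> t * A * B <= K * L * (t * P * Q).
Proof.
intros Ht HA HB H1 H2.
replace (K * L * (t * P * Q)) with (t * (K * P) * (L * Q)) by ring.
apply Rmult_le_compat; try easy; [now apply Rmult_le_pos|].
now apply Rmult_le_compat_l.
Qed.

Lemma dpsum_spec (a : nat -> nat -> C) (rho : R) (p q : nat) (x y : C) :
  dominated a rho -> Cmod x < rho -> Cmod y < rho ->
  is_dsum (fun m n => a m n * phi p m x * phi q n y)%C (dpsum a p q x y).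
Proof.
intros Ha Hx Hy; unfold dpsum, dsum; apply epsilon_spec.
pose proof (Cmod_ge_0 x); pose proof (Cmod_ge_0 y).
set (s := Rmax (Cmod x) (Cmod y)).
assert (Hs : s < rho) by now apply Rmax_lub_lt.
pose proof (Rmax_l (Cmod x) (Cmod y)); pose proof (Rmax_r (Cmod x) (Cmod y)); fold s in H1, H2.
(* The points lie within [t], domination is used at [t'], and the gap absorbs the factors from
   differentiation. *)
set (t := (s + rho) / 2); set (t' := (t + rho) / 2).
assert (Ht : s < t /\ t < t' /\ t' < rho) by (unfold t', t; lra).
destruct (phi_bound p t t' ltac:(lra)) as [K [HK HP]].
destruct (phi_bound q t t' ltac:(lra)) as [L [HL HQ]].
destruct (Ha t' ltac:(lra)) as [M HM].
apply (ex_dsum _ (fun m n => K * L * (Cmod (a m n) * t' ^ m * t' ^ n)) (K * L * M)).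
- intros m n; rewrite !Cmod_mult.
  apply product_bound; try apply Cmod_ge_0; [apply HP|apply HQ]; lra.
- intros N; rewrite dsq_scal; apply Rmult_le_compat_l; [nra|apply HM].
Qed.

(* Square partial sums are symmetric in the two indices, so the second variable
   reduces to the first by transposition. *)
Lemma dpsum_swap (a : nat -> nat -> C) (rho : R) (p q : nat) (x y : C) :
  dominated a rho -> Cmod x < rho -> Cmod y < rho ->
  dpsum a p q x y = dpsum (fun m n => a n m) q p y x.
Proof.
intros Ha Hx Hy; eapply is_dsum_unique; [now apply dpsum_spec with rho|].
pose proof (dpsum_spec _ rho q p y x (dominated_swap _ _ Ha) Hy Hx) as H.
apply is_dsum_swap in H; revert H; apply is_dsum_ext; intros m n; ring.
Qed.

(** By [phi_quad] the remainders of the monomials are quadratic in [h] with a summable majorant, so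
    the series has a quadratic remainder and [cder_quad] applies. *)
Lemma dpsum_cder1 (a : nat -> nat -> C) (rho : R) (p q : nat) (x y : C) :
  dominated a rho -> Cmod x < rho -> Cmod y < rho ->
  cder (fun x => dpsum a p q x y) x (dpsum a (S p) q x y).
Proof.
intros Ha Hx Hy.
pose proof (Cmod_ge_0 x); pose proof (Cmod_ge_0 y).
set (s := Rmax (Cmod x) (Cmod y)).
assert (Hs : s < rho) by now apply Rmax_lub_lt.
pose proof (Rmax_l (Cmod x) (Cmod y)); pose proof (Rmax_r (Cmod x) (Cmod y)); fold s in H1, H2.
set (t := (s + rho) / 2); set (t' := (t + rho) / 2).
assert (Ht : s < t /\ t < t' /\ t' < rho) by (unfold t', t; lra).
destruct (phi_quad p t t' ltac:(lra)) as [K [HK HP]].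
destruct (phi_bound q t t' ltac:(lra)) as [L [HL HQ]].
destruct (Ha t' ltac:(lra)) as [M HM].
(* Increments shorter than [t - s] keep [x + h] within radius [t], where [phi_quad] holds. *)
apply (cder_quad _ _ _ (t - s) (K * L * M)); [lra|]; intros h Hh.
assert (Hxh : Cmod (x + h)%C <= t) by (pose proof (Cmod_triangle x h); lra).
assert (D : is_dsum (fun m n => a m n * (phi p m (x + h) - phi p m x - h * phi (S p) m x)
    * phi q n y)%C
  (dpsum a p q (x + h) y + (RtoC (-1) * dpsum a p q x y + - h * dpsum a (S p) q x y))%C).
{ eapply is_dsum_ext; [|apply is_dsum_plus; [|apply is_dsum_plus; apply is_dsum_scal];
    apply dpsum_spec with rho; try easy; lra].
  intros m n; simpl; ring. }
replace (dpsum a p q (x + h) y - dpsum a p q x y - h * dpsum a (S p) q x y)%C with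
  (dpsum a p q (x + h) y + (RtoC (-1) * dpsum a p q x y + - h * dpsum a (S p) q x y))%C
  by ring.
revert D; apply is_dsum_bound; intros N.
apply Rle_trans with (dsq (G := R_AbelianMonoid)
  (fun m n => K * L * Cmod h ^ 2 * (Cmod (a m n) * t' ^ m * t' ^ n)) N).
- apply Cmod_dsq_le; intros m n; rewrite !Cmod_mult.
  replace (K * L * Cmod h ^ 2 * (Cmod (a m n) * t' ^ m * t' ^ n)) with
    (K * Cmod h ^ 2 * L * (Cmod (a m n) * t' ^ m * t' ^ n)) by ring.
  apply product_bound; try apply Cmod_ge_0.
  + replace (K * Cmod h ^ 2 * t' ^ m) with (K * t' ^ m * Cmod h ^ 2) by ring.
    apply HP; lra.
  + apply HQ; lra.
- rewrite dsq_scal.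
  replace (K * L * M * Cmod h ^ 2) with (K * L * Cmod h ^ 2 * M) by ring.
  apply Rmult_le_compat_l; [|apply HM].
  apply Rmult_le_pos; [now apply Rmult_le_pos|apply pow_le, Cmod_ge_0].
Qed.

Lemma dpsum_cder2 (a : nat -> nat -> C) (rho : R) (p q : nat) (x y : C) :
  dominated a rho -> Cmod x < rho -> Cmod y < rho ->
  cder (fun y => dpsum a p q x y) y (dpsum a p (S q) x y).
Proof.
intros Ha Hx Hy.
rewrite (dpsum_swap a rho) by easy.
apply (cder_ext_loc (fun y => dpsum (fun m n => a n m) q p y x) _ _ _ (rho - Cmod y)); [lra| |].
- intros w Hw. symmetry; apply (dpsum_swap a rho); try easy.
  replace w with (w - y + y)%C by ring.
  pose proof (Cmod_triangle (w - y) y). lra.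
- now apply dpsum_cder1 with rho; [apply dominated_swap| |].
Qed.

Lemma Cmod_sub_le (x y z : C) : Cmod (x - z)%C <= Cmod (x - y)%C + Cmod (y - z)%C.
Proof. replace (x - z)%C with (x - y + (y - z))%C by ring; apply Cmod_triangle. Qed.

Lemma Cmod_shift (x y : C) : Cmod x <= Cmod (x - y)%C + Cmod y.
Proof. replace x with (x - y + y)%C at 1 by ring; apply Cmod_triangle. Qed.

Lemma cder_shift (f : C -> C) (x c l : C) :
  cder f (x - c)%C l -> cder (fun w => f (w - c)%C) x l.
Proof.
intros H eps Heps; destruct (H eps Heps) as [d [Hd K]].
exists d; split; [easy|]; intros h Hh.
replace (x + h - c)%C with (x - c + h)%C by ring; now apply K.
Qed.

Lemma analytic_local_expansion (F : C * C -> C) (z0 : C * C) :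
  analytic_D2 F -> in_D2 z0 ->
  exists rho a, 0 < rho /\ dominated a rho /\
    forall z, Cmod (fst z - fst z0)%C < rho -> Cmod (snd z - snd z0)%C < rho ->
      F z = dpsum a 0 0 (fst z - fst z0)%C (snd z - snd z0)%C.
Proof.
intros HF Hz0; destruct (HF z0 Hz0) as [r [Hr [a Ha]]]; destruct Hz0 as [H1 H2].
(* Small enough for the bidisc around [z0] to lie in the domain, so membership need not be carried
   further. *)
set (rho := Rmin r (Rmin (1 - Cmod (fst z0)) (1 - Cmod (snd z0)))).
pose proof (Rmin_l r (Rmin (1 - Cmod (fst z0)) (1 - Cmod (snd z0)))) as M1.
pose proof (Rmin_r r (Rmin (1 - Cmod (fst z0)) (1 - Cmod (snd z0)))) as M2.
pose proof (Rmin_l (1 - Cmod (fst z0)) (1 - Cmod (snd z0))) as M3.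
pose proof (Rmin_r (1 - Cmod (fst z0)) (1 - Cmod (snd z0))) as M4.
fold rho in M1, M2.
assert (Hin : forall z, Cmod (fst z - fst z0)%C < rho -> Cmod (snd z - snd z0)%C < rho ->
  in_D2 z).
{ intros z K1 K2.
  pose proof (Cmod_shift (fst z) (fst z0)); pose proof (Cmod_shift (snd z) (snd z0)).
  split; lra. }
assert (Hdom : dominated a rho).
{ intros t Ht.
  (* At this displacement both moduli equal [t], so the absolute sums of [analytic_D2] are those of
     [dominated]. *)
  pose (z := ((fst z0 + RtoC t)%C, (snd z0 + RtoC t)%C) : C * C).
  assert (E1 : (fst z - fst z0 = RtoC t)%C) by (simpl; ring).
  assert (E2 : (snd z - snd z0 = RtoC t)%C) by (simpl; ring).
  assert (Ct : Cmod (RtoC t) = t) by (rewrite Cmod_R, Rabs_pos_eq; lra).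
  destruct (Ha z) as [[M HM] _]; rewrite ?E1, ?E2, ?Ct; try lra.
  - apply Hin; rewrite ?E1, ?E2, ?Ct; lra.
  - exists M; intros N; specialize (HM N); rewrite E1, E2, Ct in HM; exact HM. }
exists rho, a; split; [|split; [easy|]].
{ unfold rho; repeat apply Rmin_pos; lra. }
intros z K1 K2.
destruct (Ha z) as [_ L]; [now apply Hin|lra|lra|].
apply (is_dsum_unique (fun m n => a m n * phi 0 m (fst z - fst z0) * phi 0 n (snd z - snd z0))%C);
  [|now apply dpsum_spec with rho].
revert L; apply is_dsum_ext; intros m n.
reflexivity.
Qed.

(** Each differentiation needs the previous identity on a neighbourhood, so the induction runs over
    the whole bidisc and not at [z0] alone. *)
Lemma pderiv_local (F : C * C -> C) (z0 : C * C) (rho : R) (a : nat -> nat -> C) :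
  dominated a rho ->
  (forall z, Cmod (fst z - fst z0)%C < rho -> Cmod (snd z - snd z0)%C < rho ->
      F z = dpsum a 0 0 (fst z - fst z0)%C (snd z - snd z0)%C) ->
  forall p q z, Cmod (fst z - fst z0)%C < rho -> Cmod (snd z - snd z0)%C < rho ->
    pderiv F p q z = dpsum a p q (fst z - fst z0)%C (snd z - snd z0)%C.
Proof.
intros Ha HF p q; unfold pderiv; induction p as [|p IHp].
- induction q as [|q IHq]; [exact HF|]; intros [z1 z2] K1 K2.
  cbn [fst snd] in K1, K2 |- *.
  cbn [Nat.iter nat_rect]; unfold pd1, pd2; cbn [fst snd].
  apply cderiv_eq.
  apply (cder_ext_loc (fun w => dpsum a 0 q (z1 - fst z0)%C (w - snd z0)%C) _ _ _
    (rho - Cmod (z2 - snd z0)%C)); [lra| |].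
  + intros w Hw; symmetry; apply (IHq (z1, w)); [easy|cbn [fst snd]].
    pose proof (Cmod_sub_le w z2 (snd z0)); lra.
  + apply (cder_shift (fun w => dpsum a 0 q (z1 - fst z0) w)).
    now apply dpsum_cder2 with rho.
- intros [z1 z2] K1 K2.
  cbn [fst snd] in K1, K2 |- *.
  cbn [Nat.iter nat_rect]; unfold pd1, pd2; cbn [fst snd].
  apply cderiv_eq.
  apply (cder_ext_loc (fun w => dpsum a p q (w - fst z0)%C (z2 - snd z0)%C) _ _ _
    (rho - Cmod (z1 - fst z0)%C)); [lra| |].
  + intros w Hw; symmetry; apply (IHp (w, z2)); [cbn [fst snd]|easy].
    pose proof (Cmod_sub_le w z1 (fst z0)); lra.
  + apply (cder_shift (fun w => dpsum a p q w (z2 - snd z0))).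
    now apply dpsum_cder1 with rho.
Qed.

(** [pderiv] differentiates in the second variable first, so the second half contains the symmetry
    of mixed derivatives. It comes from the expansion, which can be differentiated in either
    variable at any stage. *)
Lemma pderiv_cder (F : C * C -> C) (z1 z2 : C) (p q : nat) :
  analytic_D2 F -> in_D2 (z1, z2) ->
  cder (fun w => pderiv F p q (w, z2)) z1 (pderiv F (S p) q (z1, z2)) /\
  cder (fun w => pderiv F p q (z1, w)) z2 (pderiv F p (S q) (z1, z2)).
Proof.
intros HF Hz.
destruct (analytic_local_expansion F (z1, z2) HF Hz) as [rho [a [Hrho [Ha E]]]].
pose proof (pderiv_local F (z1, z2) rho a Ha E) as L; simpl in L.
assert (Z : forall x : C, Cmod (x - x)%C < rho).
{ intros x; replace (x - x)%C with (RtoC 0) by ring; now rewrite Cmod_0. }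
rewrite !L by apply Z; split.
- apply (cder_ext_loc (fun w => dpsum a p q (w - z1)%C (z2 - z2)%C) _ _ _ rho); [easy| |].
  + intros w Hw; symmetry; now apply (L p q (w, z2)).
  + apply (cder_shift (fun w => dpsum a p q w (z2 - z2))).
    apply dpsum_cder1 with rho; try easy; apply Z.
- apply (cder_ext_loc (fun w => dpsum a p q (z1 - z1)%C (w - z2)%C) _ _ _ rho); [easy| |].
  + intros w Hw; symmetry; now apply (L p q (z1, w)).
  + apply (cder_shift (fun w => dpsum a p q (z1 - z1) w)).
    apply dpsum_cder2 with rho; try easy; apply Z.
Qed.

(** * Curves and circle integrals *)

Lemma is_derive_eps (f : R -> R) (x l : R) :
  is_derive f x l <->
  forall eps, 0 < eps -> exists del, 0 < del /\ forall h, Rabs h < del ->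
    Rabs (f (x + h) - f x - h * l) <= eps * Rabs h.
Proof.
split.
- intros [_ H] eps Heps.
  destruct (H x (fun P HP => HP) (mkposreal eps Heps)) as [del Hd].
  exists del; split; [apply cond_pos|]; intros h Hh.
  specialize (Hd (x + h)).
  change (Rabs (x + h - x) < del ->
    Rabs (f (x + h) - f x - (x + h - x) * l) <= eps * Rabs (x + h - x)) in Hd.
  replace (x + h - x) with h in Hd by ring; now apply Hd.
- intros H; split; [apply is_linear_scal_l|].
  intros y Hy eps.
  rewrite <- (is_filter_lim_locally_unique (V := R_NormedModule) _ _ Hy); clear y Hy.
  destruct (H eps (cond_pos eps)) as [del [Hdel Hd]].
  exists (mkposreal del Hdel); intros y Hy.
  change (Rabs (y - x) < del) in Hy.
  change (Rabs (f y - f x - (y - x) * l) <= eps * Rabs (y - x)).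
  specialize (Hd (y - x) Hy).
  now rewrite Rplus_minus in Hd.
Qed.

(** Componentwise, so that real differentiation and integration apply to the two parts. *)
Definition cvder (g : R -> C) (t : R) (d : C) : Prop :=
  is_derive (fun t => Re (g t)) t (Re d) /\ is_derive (fun t => Im (g t)) t (Im d).

Lemma Cmod_le_Re_Im (z : C) : Cmod z <= Rabs (Re z) + Rabs (Im z).
Proof.
replace z with (RtoC (Re z) + Ci * RtoC (Im z))%C at 1
  by (destruct z; unfold RtoC, Ci, Cplus, Cmult, Re, Im; simpl; f_equal; ring).
eapply Rle_trans; [apply Cmod_triangle|].
rewrite Cmod_mult, Cmod_Ci, !Cmod_R; lra.
Qed.

Lemma im_le_Cmod (z : C) : Rabs (Im z) <= Cmod z.
Proof. eapply Rle_trans; [apply Rmax_r|apply Rmax_Cmod]. Qed.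

Lemma cvder_eps (g : R -> C) (t : R) (d : C) :
  cvder g t d <->
  forall eps, 0 < eps -> exists del, 0 < del /\ forall s, Rabs s < del ->
    Cmod (g (t + s)%R - g t - RtoC s * d)%C <= eps * Rabs s.
Proof.
assert (ER : forall s, Re (g (t + s)%R - g t - RtoC s * d)%C
  = Re (g (t + s)) - Re (g t) - s * Re d).
{ intros s; destruct d; unfold Re, Cminus, Copp, Cplus, Cmult, RtoC; simpl; ring. }
assert (EI : forall s, Im (g (t + s)%R - g t - RtoC s * d)%C
  = Im (g (t + s)) - Im (g t) - s * Im d).
{ intros s; destruct d; unfold Im, Cminus, Copp, Cplus, Cmult, RtoC; simpl; ring. }
unfold cvder; rewrite !is_derive_eps; split.
- intros [H1 H2] eps Heps.
  destruct (H1 (eps / 2) ltac:(lra)) as [d1 [Hd1 K1]].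
  destruct (H2 (eps / 2) ltac:(lra)) as [d2 [Hd2 K2]].
  exists (Rmin d1 d2); split; [now apply Rmin_pos|]; intros s Hs.
  pose proof (Rmin_l d1 d2); pose proof (Rmin_r d1 d2).
  eapply Rle_trans; [apply Cmod_le_Re_Im|]; rewrite ER, EI.
  specialize (K1 s ltac:(lra)); specialize (K2 s ltac:(lra)); lra.
- intros H; split; intros eps Heps; destruct (H eps Heps) as [del [Hd K]];
    exists del; (split; [easy|]); intros s Hs;
    (eapply Rle_trans; [|apply (K s Hs)]).
  + rewrite <- ER; apply re_le_Cmod.
  + rewrite <- EI; apply im_le_Cmod.
Qed.

Lemma cvder_cder (f : C -> C) (g : R -> C) (t : R) (l d : C) :
  cder f (g t) l -> cvder g t d -> cvder (fun t => f (g t)) t (l * d)%C.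
Proof.
rewrite !cvder_eps; intros Hf Hg eps Heps.
pose proof (Cmod_ge_0 l) as Pl; pose proof (Cmod_ge_0 d) as Pd.
(* The error is the remainder of [f] at the increment [k] plus [l] times the remainder of [g]; each
   gets [eps / 2]. The cap [e2 <= 1] gives [Cmod k <= (Cmod d + 1) * Rabs s]. *)
set (e1 := eps / (2 * (Cmod d + 1))).
set (e2 := Rmin 1 (eps / (2 * (Cmod l + 1)))).
assert (He1 : 0 < e1) by (apply Rdiv_lt_0_compat; lra).
assert (He2' : 0 < eps / (2 * (Cmod l + 1))) by (apply Rdiv_lt_0_compat; lra).
assert (He2 : 0 < e2) by (apply Rmin_pos; lra).
assert (E1 : e1 * (Cmod d + 1) = eps / 2) by (unfold e1; field; lra).
assert (E2 : e2 * (Cmod l + 1) <= eps / 2).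
{ replace (eps / 2) with (eps / (2 * (Cmod l + 1)) * (Cmod l + 1)) by (field; lra).
  apply Rmult_le_compat_r; [lra|apply Rmin_r]. }
assert (E3 : e2 <= 1) by apply Rmin_l.
destruct (Hf e1 He1) as [d1 [Hd1 K1]].
destruct (Hg e2 He2) as [d2 [Hd2 K2]].
assert (Hd3 : 0 < d1 / (Cmod d + 1)) by (apply Rdiv_lt_0_compat; lra).
exists (Rmin d2 (d1 / (Cmod d + 1))); split; [now apply Rmin_pos|]; intros s Hs.
pose proof (Rmin_l d2 (d1 / (Cmod d + 1))); pose proof (Rmin_r d2 (d1 / (Cmod d + 1))).
specialize (K2 s ltac:(lra)).
set (k := (g (t + s)%R - g t)%C) in *.
pose proof (Rabs_pos s) as Ps.
assert (Hk : Cmod k <= (Cmod d + 1) * Rabs s).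
{ replace k with (k - RtoC s * d + RtoC s * d)%C by ring.
  eapply Rle_trans; [apply Cmod_triangle|]. rewrite Cmod_mult, Cmod_R. nra. }
assert (Hk' : Cmod k < d1).
{ eapply Rle_lt_trans; [apply Hk|].
  replace d1 with ((Cmod d + 1) * (d1 / (Cmod d + 1))) by (field; lra).
  apply Rmult_lt_compat_l; lra. }
specialize (K1 k Hk').
replace (f (g (t + s)%R) - f (g t) - RtoC s * (l * d))%C with
  ((f (g t + k) - f (g t) - k * l) + l * (k - RtoC s * d))%C
  by (unfold k; rewrite Cplus_minus_cancel; ring).
eapply Rle_trans; [apply Cmod_triangle|]. rewrite Cmod_mult.
assert (e1 * Cmod k <= eps / 2 * Rabs s).
{ rewrite <- E1, Rmult_assoc; apply Rmult_le_compat_l; lra. }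
assert (Cmod l * Cmod (k - RtoC s * d)%C <= eps / 2 * Rabs s); [|lra].
apply Rle_trans with (Cmod l * (e2 * Rabs s)); [now apply Rmult_le_compat_l|]. nra.
Qed.

Lemma cvder_mult (g h : R -> C) (t : R) (d e : C) :
  cvder g t d -> cvder h t e -> cvder (fun t => g t * h t)%C t (d * h t + g t * e)%C.
Proof.
intros [G1 G2] [H1 H2]; split.
- apply (is_derive_ext (fun t => Re (g t) * Re (h t) - Im (g t) * Im (h t))); [reflexivity|].
  evar_last.
  { apply (is_derive_minus (K := R_AbsRing) (V := R_NormedModule));
      apply (is_derive_mult (K := R_AbsRing)); eauto; intros; apply Rmult_comm. }
  destruct d, e; unfold Re, Im, minus, plus, opp, mult, Cplus, Cmult; simpl; ring.
- apply (is_derive_ext (fun t => Re (g t) * Im (h t) + Im (g t) * Re (h t))); [reflexivity|].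
  evar_last.
  { apply (is_derive_plus (K := R_AbsRing) (V := R_NormedModule));
      apply (is_derive_mult (K := R_AbsRing)); eauto; intros; apply Rmult_comm. }
  destruct d, e; unfold Re, Im, plus, mult, Cplus, Cmult; simpl; ring.
Qed.

Definition expi (t : R) : C := (cos t, sin t).

Lemma expi_plus (s t : R) : expi (s + t) = (expi s * expi t)%C.
Proof. unfold expi, Cmult; simpl; rewrite cos_plus, sin_plus; f_equal; ring. Qed.

Lemma Cmod_expi (t : R) : Cmod (expi t) = 1.
Proof.
unfold Cmod, expi; simpl.
replace (cos t * (cos t * 1) + sin t * (sin t * 1)) with 1; [apply sqrt_1|].
pose proof (sin2_cos2 t); unfold Rsqr in *; lra.
Qed.

Lemma expi_period (n : nat) : expi (- INR n * (2 * PI)) = RtoC 1.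
Proof.
assert (E : 0 + 2 * INR n * PI = INR n * (2 * PI)) by ring.
unfold expi, RtoC; f_equal.
- rewrite Ropp_mult_distr_l_reverse, cos_neg, <- E, cos_period; apply cos_0.
- rewrite Ropp_mult_distr_l_reverse, sin_neg, <- E, sin_period, sin_0; ring.
Qed.

Lemma cvder_expi (k t : R) : cvder (fun t => expi (k * t)) t (RtoC k * Ci * expi (k * t))%C.
Proof.
split; unfold expi, Re, Im; simpl; auto_derive; trivial; ring.
Qed.

Definition circ (a : C) (r t : R) : C := (a + RtoC r * expi t)%C.

Lemma Cmod_circ (a : C) (r t : R) : Cmod (circ a r t - a)%C = Rabs r.
Proof.
unfold circ; replace (a + RtoC r * expi t - a)%C with (RtoC r * expi t)%C by ring.
rewrite Cmod_mult, Cmod_expi, Cmod_R; ring.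
Qed.

Lemma cvder_circ (a : C) (r t : R) : cvder (circ a r) t (RtoC r * Ci * expi t)%C.
Proof.
destruct a; split; unfold circ, expi, Re, Im; simpl; auto_derive; trivial; ring.
Qed.

Lemma cvder_radius (a : C) (r s t : R) :
  cvder (fun s => circ a (s * r) t) s (RtoC r * expi t)%C.
Proof.
destruct a; split; unfold circ, expi, Re, Im; simpl; auto_derive; trivial; ring.
Qed.

Lemma cvder_continuous (g : R -> C) (t : R) (d : C) :
  cvder g t d -> continuous (fun t => Re (g t)) t /\ continuous (fun t => Im (g t)) t.
Proof.
intros [H1 H2]; split; apply (ex_derive_continuous (K := R_AbsRing) (V := R_NormedModule));
  eexists; eassumption.
Qed.

Lemma circ_continuous (g g' : C -> C) (a : C) (sigma r k t : R) :
  (forall x, Cmod (x - a)%C < sigma -> cder g x (g' x)) -> Rabs r < sigma ->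
  continuous (fun t => Re (g (circ a r t) * expi (k * t))%C) t.
Proof.
intros Hg Hr.
apply (cvder_continuous (fun t => g (circ a r t) * expi (k * t))%C t
  (g' (circ a r t) * (RtoC r * Ci * expi t) * expi (k * t)
    + g (circ a r t) * (RtoC k * Ci * expi (k * t)))%C).
apply (cvder_mult (fun t => g (circ a r t)) (fun t => expi (k * t))); [|apply cvder_expi].
apply (cvder_cder g (circ a r)); [|apply cvder_circ]. apply Hg; now rewrite Cmod_circ.
Qed.

Lemma ex_RInt_circ (g g' : C -> C) (a : C) (sigma r k : R) :
  (forall x, Cmod (x - a)%C < sigma -> cder g x (g' x)) -> Rabs r < sigma ->
  ex_RInt (fun t => Re (g (circ a r t) * expi (k * t))%C) 0 (2 * PI).
Proof.
intros Hg Hr; apply (ex_RInt_continuous (V := R_CompleteNormedModule)); intros t _.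
now apply (circ_continuous g g' a sigma).
Qed.

(* The derivative of [Im (g (a + r e^(it)) e^(-int))] integrates to zero over a period. *)
Lemma circle_by_parts (g g' g'' : C -> C) (a : C) (sigma r : R) (n : nat) :
  (forall x, Cmod (x - a)%C < sigma -> cder g x (g' x)) ->
  (forall x, Cmod (x - a)%C < sigma -> cder g' x (g'' x)) ->
  Rabs r < sigma ->
  r * RInt (fun t => Re (g' (circ a r t) * expi ((1 + - INR n) * t))%C) 0 (2 * PI) =
  INR n * RInt (fun t => Re (g (circ a r t) * expi (- INR n * t))%C) 0 (2 * PI).
Proof.
intros Hg Hg' Hr.
set (k := - INR n).
assert (I : is_RInt (fun t => minus
    (scal r (Re (g' (circ a r t) * expi ((1 + k) * t))%C))
    (scal (INR n) (Re (g (circ a r t) * expi (k * t))%C))) 0 (2 * PI) 0).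
{ evar_last.
  (* Differentiating the exponentials brings out a factor [Ci], which turns the imaginary part into
     the real parts of the two integrands. *)
  - apply (is_RInt_derive (V := R_CompleteNormedModule)
      (fun t => Im (g (circ a r t) * expi (k * t))%C)).
    + intros t _.
      assert (Hc : Cmod (circ a r t - a)%C < sigma) by now rewrite Cmod_circ.
      assert (D := cvder_mult (fun t => g (circ a r t)) (fun t => expi (k * t)) t _ _
        (cvder_cder g (circ a r) t _ _ (Hg _ Hc) (cvder_circ a r t))
        (cvder_expi k t)).
      apply proj2 in D; evar_last; [exact D|].
      assert (E : expi ((1 + k) * t) = (expi t * expi (k * t))%C).
      { rewrite <- expi_plus; f_equal; ring. }
      rewrite E; unfold k.
      destruct (g' (circ a r t)), (g (circ a r t)), (expi t), (expi (- INR n * t)).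
      unfold Re, Im, minus, plus, opp, scal; simpl; unfold mult; simpl; ring.
    + intros t _.
      apply (continuous_minus (K := R_AbsRing) (V := R_NormedModule));
        apply (continuous_scal_r (K := R_AbsRing) (V := R_NormedModule)).
      * now apply (circ_continuous g' g'' a sigma).
      * now apply (circ_continuous g g' a sigma).
  - cbv beta.
    replace (circ a r (2 * PI)) with (circ a r 0)
      by (unfold circ, expi; rewrite cos_2PI, sin_2PI, cos_0, sin_0; reflexivity).
    unfold k; rewrite expi_period.
    replace (expi (- INR n * 0)) with (RtoC 1)
      by (unfold expi, RtoC; rewrite Rmult_0_r, cos_0, sin_0; reflexivity).
    apply (minus_eq_zero (G := R_AbelianGroup)). }
pose proof (ex_RInt_circ g' g'' a sigma r (1 + k) Hg' Hr) as X1.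
pose proof (ex_RInt_circ g g' a sigma r k Hg Hr) as X2.
apply (RInt_correct (V := R_CompleteNormedModule)) in X1.
apply (RInt_correct (V := R_CompleteNormedModule)) in X2.
pose proof (is_RInt_minus (V := R_NormedModule) _ _ _ _ _ _
  (is_RInt_scal (V := R_NormedModule) _ _ _ r _ X1)
  (is_RInt_scal (V := R_NormedModule) _ _ _ (INR n) _ X2)) as J.
apply (is_RInt_unique (V := R_CompleteNormedModule)) in I.
apply (is_RInt_unique (V := R_CompleteNormedModule)) in J.
apply Rminus_diag_uniq; unfold minus, plus, opp, scal in J; simpl in J.
exact (eq_trans (eq_sym J) I).
Qed.

(** * Cauchy estimates *)

Lemma cder_continuous (f : C -> C) (x l : C) :
  cder f x l -> forall eps, 0 < eps -> exists del, 0 < del /\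
    forall y, Cmod (y - x)%C < del -> Cmod (f y - f x)%C < eps.
Proof.
intros H eps Heps.
destruct (H 1 Rlt_0_1) as [d [Hd K]].
pose proof (Cmod_ge_0 l) as Pl.
assert (Hq : 0 < eps / (Cmod l + 2)) by (apply Rdiv_lt_0_compat; lra).
exists (Rmin d (eps / (Cmod l + 2))); split; [now apply Rmin_pos|]; intros y Hy.
pose proof (Rmin_l d (eps / (Cmod l + 2))); pose proof (Rmin_r d (eps / (Cmod l + 2))).
specialize (K (y - x)%C ltac:(lra)); rewrite Cplus_minus_cancel in K.
replace (f y - f x)%C with (f y - f x - (y - x) * l + (y - x) * l)%C by ring.
eapply Rle_lt_trans; [apply Cmod_triangle|]; rewrite Cmod_mult.
assert (Cmod (y - x)%C * (Cmod l + 2) < eps).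
{ replace eps with (eps / (Cmod l + 2) * (Cmod l + 2)) at 1 by (field; lra).
  apply Rmult_lt_compat_r; lra. }
pose proof (Cmod_ge_0 (y - x)%C); nra.
Qed.

(** Joint continuity in radius and angle, as differentiation under the integral sign requires. *)
Lemma continuity_2d_circ (g : C -> C) (a l : C) (r s t : R) :
  cder g (circ a (s * r) t) l ->
  continuity_2d_pt (fun u v => Re (g (circ a (u * r) v))) s t /\
  continuity_2d_pt (fun u v => Im (g (circ a (u * r) v))) s t.
Proof.
intros H.
assert (G : forall eps : posreal, locally_2d
  (fun u v => Cmod (g (circ a (u * r) v) - g (circ a (s * r) t))%C < eps) s t).
{ intros eps; destruct (cder_continuous _ _ _ H eps (cond_pos eps)) as [d [Hd K]].
  assert (C1 : continuity_2d_pt (fun u v => u * r * cos v) s t).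
  { apply continuity_2d_pt_mult.
    - apply continuity_2d_pt_mult; [apply continuity_2d_pt_id1|apply continuity_2d_pt_const].
    - apply (continuity_1d_2d_pt_comp cos (fun _ v => v));
        [apply continuity_cos|apply continuity_2d_pt_id2]. }
  assert (C2 : continuity_2d_pt (fun u v => u * r * sin v) s t).
  { apply continuity_2d_pt_mult.
    - apply continuity_2d_pt_mult; [apply continuity_2d_pt_id1|apply continuity_2d_pt_const].
    - apply (continuity_1d_2d_pt_comp sin (fun _ v => v));
        [apply continuity_sin|apply continuity_2d_pt_id2]. }
  assert (Hd2 : 0 < d / 2) by lra.
  generalize (locally_2d_and _ _ _ _ (C1 (mkposreal _ Hd2)) (C2 (mkposreal _ Hd2))).
  apply locally_2d_impl, locally_2d_forall; intros u v [K1 K2]; simpl in K1, K2.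
  apply K; eapply Rle_lt_trans; [apply Cmod_le_Re_Im|].
  replace (Re (circ a (u * r) v - circ a (s * r) t)%C) with (u * r * cos v - s * r * cos t)
    by (destruct a; unfold circ, expi, Re; simpl; ring).
  replace (Im (circ a (u * r) v - circ a (s * r) t)%C) with (u * r * sin v - s * r * sin t)
    by (destruct a; unfold circ, expi, Im; simpl; ring).
  lra. }
split; intros eps; generalize (G eps); apply locally_2d_impl, locally_2d_forall; intros u v K;
  (eapply Rle_lt_trans; [|apply K]).
- eapply Rle_trans; [|apply re_le_Cmod]; right; reflexivity.
- eapply Rle_trans; [|apply im_le_Cmod]; right; reflexivity.
Qed.

(** The integral over the circle of radius [s * r] is constant in [s]: its derivative integrates
    [g'] against [r * expi t], which vanishes by [circle_by_parts] at frequency 0. At [s = 0] the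
    integrand is constant. *)
Lemma circle_mean_value (g g' g'' : C -> C) (a : C) (sigma r : R) :
  (forall x, Cmod (x - a)%C < sigma -> cder g x (g' x)) ->
  (forall x, Cmod (x - a)%C < sigma -> cder g' x (g'' x)) ->
  0 < r < sigma ->
  RInt (fun t => Re (g (circ a r t))) 0 (2 * PI) = 2 * PI * Re (g a).
Proof.
intros Hg Hg' Hr.
assert (Hin : forall s t, Rabs s < sigma / r -> Cmod (circ a (s * r) t - a)%C < sigma).
{ intros s t Hs; rewrite Cmod_circ, Rabs_mult, (Rabs_pos_eq r) by lra.
  replace sigma with (sigma / r * r) by (field; lra).
  apply Rmult_lt_compat_r; lra. }
(* This leaves room for two-sided derivatives in [s] on all of [[0, 1]], ends included. *)
assert (Hsig : 1 < sigma / r).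
{ apply (Rmult_lt_reg_r r); [lra|]. replace (sigma / r * r) with sigma by (field; lra). lra. }
set (D := fun s t => Re (g' (circ a (s * r) t) * (RtoC r * expi t))%C).
assert (HD : forall s t, Rabs s < sigma / r ->
  is_derive (fun s => Re (g (circ a (s * r) t))) s (D s t)).
{ intros s t Hs.
  apply (cvder_cder g (fun s => circ a (s * r) t)); [|apply cvder_radius].
  apply Hg, Hin, Hs. }
assert (Hnear : forall s, Rabs s < sigma / r -> locally s (fun u => Rabs u < sigma / r)).
{ intros s Hs; assert (Hp : 0 < sigma / r - Rabs s) by lra.
  exists (mkposreal _ Hp); intros u Hu; change (Rabs (u - s) < sigma / r - Rabs s) in Hu.
  pose proof (Rabs_triang_inv u s); lra. }
assert (HI : forall s, Rabs s < sigma / r ->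
  is_derive (fun s => RInt (fun t => Re (g (circ a (s * r) t))) 0 (2 * PI)) s
    (RInt (D s) 0 (2 * PI))).
{ intros s Hs.
  rewrite (RInt_ext (D s) (fun t => Derive (fun u => Re (g (circ a (u * r) t))) s))
    by (intros; symmetry; now apply is_derive_unique, HD).
  apply (is_derive_RInt_param (fun s t => Re (g (circ a (s * r) t)))).
  - generalize (Hnear s Hs); apply filter_imp; intros u Hu t _.
    eexists; now apply HD.
  - intros t _.
    apply (continuity_2d_pt_ext_loc D).
    { destruct (Hnear s Hs) as [d Hd]; exists d; intros u v Hu _.
      symmetry; apply is_derive_unique, HD, Hd, Hu. }
    destruct (continuity_2d_circ g' a _ r s t (Hg' _ (Hin s t Hs))) as [C1 C2].
    apply (continuity_2d_pt_ext (fun u v => Re (g' (circ a (u * r) v)) * (r * cos v)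
      - Im (g' (circ a (u * r) v)) * (r * sin v))).
    { intros u v; unfold D, expi, Re, Im; simpl; ring. }
    apply continuity_2d_pt_minus; apply continuity_2d_pt_mult; try easy;
      apply continuity_2d_pt_mult; try apply continuity_2d_pt_const.
    + apply (continuity_1d_2d_pt_comp cos (fun _ v => v));
        [apply continuity_cos|apply continuity_2d_pt_id2].
    + apply (continuity_1d_2d_pt_comp sin (fun _ v => v));
        [apply continuity_sin|apply continuity_2d_pt_id2].
  - generalize (Hnear s Hs); apply filter_imp; intros u Hu.
    apply (ex_RInt_ext (fun t => Re (g (circ a (u * r) t) * expi (0 * t))%C)).
    { intros t _; unfold expi; rewrite Rmult_0_l, cos_0, sin_0; unfold Re; simpl; ring. }
    apply (ex_RInt_circ g g' a sigma); [easy|].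
    rewrite <- (Cmod_circ a _ 0); now apply Hin. }
(* [circle_by_parts] only says that [s * r] times the integral vanishes, hence [s] is positive here;
   the mean value theorem asks for interior points only. *)
assert (H0 : forall s, 0 < s < 1 -> RInt (D s) 0 (2 * PI) = 0).
{ intros s Hs.
  assert (Hs' : Rabs s < sigma / r) by (rewrite Rabs_pos_eq; lra).
  assert (Hsr : Rabs (s * r) < sigma) by (rewrite <- (Cmod_circ a _ 0); now apply Hin).
  pose proof (circle_by_parts g g' g'' a sigma (s * r) 0 Hg Hg' Hsr) as P.
  simpl INR in P; rewrite Rmult_0_l in P.
  apply Rmult_integral in P; destruct P as [P|P]; [exfalso; nra|].
  rewrite (RInt_ext (V := R_CompleteNormedModule) (D s)
    (fun t => scal r (Re (g' (circ a (s * r) t) * expi ((1 + - 0) * t))%C))).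
  - rewrite (RInt_scal (V := R_CompleteNormedModule)).
    + rewrite P. apply Rmult_0_r.
    + apply (ex_RInt_circ g' g'' a sigma); easy.
  - intros t _; unfold D, expi; replace ((1 + - 0) * t) with t by ring.
    unfold Re, scal; simpl; unfold mult; simpl; ring. }
destruct (MVT_gen (fun s => RInt (fun t => Re (g (circ a (s * r) t))) 0 (2 * PI)) 0 1
  (fun _ => 0)) as [c [_ E]].
- intros s Hs; rewrite Rmin_left, Rmax_right in Hs by lra.
  assert (Hs' : Rabs s < sigma / r) by (rewrite Rabs_pos_eq; lra).
  pose proof (HI s Hs') as T; rewrite (H0 s Hs) in T; exact T.
- intros s Hs; rewrite Rmin_left, Rmax_right in Hs by lra.
  apply continuity_pt_filterlim.
  apply (ex_derive_continuous (K := R_AbsRing) (V := R_NormedModule)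
    (fun s => RInt (fun t => Re (g (circ a (s * r) t))) 0 (2 * PI)) s).
  exists (RInt (D s) 0 (2 * PI)); apply (HI s); rewrite Rabs_pos_eq; lra.
- cbv beta in E.
  assert (E0 : RInt (fun t => Re (g (circ a (0 * r) t))) 0 (2 * PI) = 2 * PI * Re (g a)).
  { rewrite (RInt_ext (V := R_CompleteNormedModule) _ (fun _ => Re (g a))).
    - rewrite RInt_const; unfold scal; simpl; unfold mult; simpl; ring.
    - intros t _; f_equal; f_equal; unfold circ; rewrite Rmult_0_l; ring. }
  assert (E1 : RInt (fun t => Re (g (circ a (1 * r) t))) 0 (2 * PI) =
    RInt (fun t => Re (g (circ a (0 * r) t))) 0 (2 * PI)) by lra.
  now rewrite <- E0, <- E1, Rmult_1_l.
Qed.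

(** Each integration by parts lowers the frequency [n] by one, raises the order [k] of the
    derivative by one and contributes a factor [r / n]; at frequency 0 the mean value property takes
    over. So [k] stays free in the induction. *)
Lemma cauchy_coeff (f : nat -> C -> C) (a : C) (sigma r : R) :
  (forall n x, Cmod (x - a)%C < sigma -> cder (f n) x (f (S n) x)) ->
  0 < r < sigma ->
  forall n k, INR (Factorial.fact n) *
    RInt (fun t => Re (f k (circ a r t) * expi (- INR n * t))%C) 0 (2 * PI)
    = r ^ n * (2 * PI * Re (f (n + k)%nat a)).
Proof.
intros Hf Hr; induction n as [|n IH]; intros k.
- change (0 + k)%nat with k.
  rewrite <- (circle_mean_value (f k) (f (S k)) (f (S (S k))) a sigma r); auto.
  simpl; rewrite !Rmult_1_l; apply RInt_ext; intros t _.
  unfold expi; replace (- 0 * t) with 0 by ring; rewrite cos_0, sin_0; unfold Re; simpl; ring.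
- assert (Hr' : Rabs r < sigma) by (rewrite Rabs_pos_eq; lra).
  pose proof (circle_by_parts (f k) (f (S k)) (f (S (S k))) a sigma r (S n)
    (Hf k) (Hf (S k)) Hr') as P.
  assert (En : 1 + - INR (S n) = - INR n) by (rewrite S_INR; ring).
  rewrite En in P.
  change (Factorial.fact (S n)) with (S n * Factorial.fact n)%nat.
  rewrite mult_INR, (Rmult_comm (INR (S n))), Rmult_assoc, <- P.
  rewrite <- Rmult_assoc, (Rmult_comm _ r), Rmult_assoc, IH.
  replace (n + S k)%nat with (S n + k)%nat by lia. simpl; ring.
Qed.

Lemma cauchy_estimate_Re (f : nat -> C -> C) (a : C) (sigma r B : R) (n : nat) :
  (forall n x, Cmod (x - a)%C < sigma -> cder (f n) x (f (S n) x)) ->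
  0 < r < sigma ->
  (forall x, Cmod (x - a)%C <= r -> Cmod (f 0%nat x) <= B) ->
  Re (f n a) <= INR (Factorial.fact n) / r ^ n * B.
Proof.
intros Hf Hr HB.
assert (Hr' : Rabs r < sigma) by (rewrite Rabs_pos_eq; lra).
pose proof (cauchy_coeff f a sigma r Hf Hr n 0) as E; rewrite Nat.add_0_r in E.
assert (I : RInt (fun t => Re (f 0%nat (circ a r t) * expi (- INR n * t))%C) 0 (2 * PI)
  <= 2 * PI * B).
{ replace (2 * PI * B) with (RInt (fun _ => B) 0 (2 * PI))
    by (rewrite RInt_const; unfold scal; simpl; unfold mult; simpl; ring).
  pose proof PI_RGT_0.
  apply RInt_le; [lra|now apply (ex_RInt_circ (f 0%nat) (f 1%nat) a sigma); auto
    |apply (ex_RInt_const (V := R_NormedModule))|].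
  intros t _.
  eapply Rle_trans; [apply Rle_abs|]; eapply Rle_trans; [apply re_le_Cmod|].
  rewrite Cmod_mult, Cmod_expi, Rmult_1_r; apply HB.
  rewrite Cmod_circ, Rabs_pos_eq; lra. }
pose proof PI_RGT_0; pose proof (pow_lt r n ltac:(lra)).
pose proof (INR_fact_lt_0 n) as Hfact.
apply (Rmult_le_reg_l (r ^ n * (2 * PI))); [nra|].
rewrite Rmult_assoc, <- E.
replace (r ^ n * (2 * PI) * (INR (Factorial.fact n) / r ^ n * B)) with
  (INR (Factorial.fact n) * (2 * PI * B)) by (field; lra).
apply Rmult_le_compat_l; [lra|easy].
Qed.

Lemma cauchy_estimate (f : nat -> C -> C) (a : C) (sigma r B : R) (n : nat) :
  (forall n x, Cmod (x - a)%C < sigma -> cder (f n) x (f (S n) x)) ->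
  0 < r < sigma ->
  (forall x, Cmod (x - a)%C <= r -> Cmod (f 0%nat x) <= B) ->
  Cmod (f n a) <= INR (Factorial.fact n) / r ^ n * B.
Proof.
intros Hf Hr HB.
(* A zero derivative has no phase to rotate; the claim then needs only [0 <= B], which [HB] gives at
   [a]. *)
destruct (Req_dec (Cmod (f n a)) 0) as [E|E].
{ rewrite E. pose proof (HB a) as Ha.
  replace (a - a)%C with (RtoC 0) in Ha by ring; rewrite Cmod_0 in Ha.
  pose proof (Cmod_ge_0 (f 0%nat a)).
  apply Rmult_le_pos; [|lra].
  apply Rmult_le_pos; [apply pos_INR|left; apply Rinv_0_lt_compat, pow_lt; lra]. }
(* Rotate so that the [n]-th derivative at [a] becomes a nonnegative real. *)
set (m := Cmod (f n a)) in *.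
set (u := (Cconj (f n a) * RtoC (/ m))%C).
assert (Hu : Cmod u = 1).
{ unfold u; rewrite Cmod_mult, Cmod_conj, Cmod_R; fold m.
  pose proof (Cmod_ge_0 (f n a)); fold m in H.
  rewrite Rabs_pos_eq; [now field|left; apply Rinv_0_lt_compat; lra]. }
replace m with (Re (u * f n a)%C).
- apply (cauchy_estimate_Re (fun n x => u * f n x)%C a sigma r B n); [|easy|].
  + intros k x Hx eps Heps.
    destruct (Hf k x Hx eps Heps) as [d [Hd K]].
    exists d; split; [easy|]; intros h Hh.
    replace (u * f k (x + h) - u * f k x - h * (u * f (S k) x))%C with
      (u * (f k (x + h) - f k x - h * f (S k) x))%C by ring.
    rewrite Cmod_mult, Hu, Rmult_1_l; now apply K.
  + intros x Hx; rewrite Cmod_mult, Hu, Rmult_1_l; now apply HB.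
- pose proof (Cmod2_alt (f n a)) as Q; fold m in Q.
  unfold u; destruct (f n a) as [p q]; unfold Re, Im in *; simpl in *.
  apply (Rmult_eq_reg_l m); [|easy].
  replace (m * m) with (p * (p * 1) + q * (q * 1)) by lra.
  field; easy.
Qed.

(** * Growth of the energy *)

Lemma dsq_const (B : R) (N : nat) :
  dsq (G := R_AbelianMonoid) (fun _ _ => B) N = INR (S N) ^ 2 * B.
Proof.
unfold dsq; rewrite (sum_n_ext _ (fun _ => INR (S N) * B)) by (intros; apply sum_n_const).
rewrite sum_n_const; simpl pow; now rewrite Rmult_1_r, Rmult_assoc.
Qed.

Lemma sum_n_nonneg (v : nat -> R) (N : nat) :
  (forall n, 0 <= v n) -> 0 <= sum_n (G := R_AbelianMonoid) v N.
Proof.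
intros H; induction N as [|N IH]; [rewrite sum_O; apply H|].
rewrite sum_Sn; now apply Rplus_le_le_0_compat.
Qed.

Lemma term_le_sum_n (v : nat -> R) (i N : nat) :
  (forall n, 0 <= v n) -> (i <= N)%nat -> v i <= sum_n (G := R_AbelianMonoid) v N.
Proof.
intros H Hi; induction N as [|N IH].
- replace i with 0%nat by lia; rewrite sum_O; apply Rle_refl.
- rewrite sum_Sn; change (v i <= sum_n (G := R_AbelianMonoid) v N + v (S N)).
  pose proof (sum_n_nonneg v N H); pose proof (H (S N)).
  destruct (Nat.eq_dec i (S N)) as [->|Hne]; [lra|].
  specialize (IH ltac:(lia)); lra.
Qed.

Lemma term_le_dsq (v : nat -> nat -> R) (i j N : nat) :
  (forall m n, 0 <= v m n) -> (i <= N)%nat -> (j <= N)%nat ->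
  v i j <= dsq (G := R_AbelianMonoid) v N.
Proof.
intros H Hi Hj.
apply Rle_trans with (sum_n (G := R_AbelianMonoid) (v i) N).
- now apply term_le_sum_n.
- apply (term_le_sum_n (fun m => sum_n (G := R_AbelianMonoid) (v m) N)); [|easy].
  intros m; now apply sum_n_nonneg.
Qed.

Lemma is_derive_dsq (v : nat -> nat -> R -> R) (d : nat -> nat -> R) (t : R) (N : nat) :
  (forall j k, is_derive (v j k) t (d j k)) ->
  is_derive (fun t => dsq (G := R_AbelianMonoid) (fun j k => v j k t) N) t
    (dsq (G := R_AbelianMonoid) d N).
Proof.
intros H; unfold dsq.
apply (is_derive_sum_n (K := R_AbsRing) (V := R_NormedModule)
  (fun m t => sum_n (G := R_AbelianMonoid) (fun k => v m k t) N)); intros m _.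
apply (is_derive_sum_n (K := R_AbsRing) (V := R_NormedModule) (fun k t => v m k t)); auto.
Qed.

Lemma is_derive_Cmod2 (g : R -> C) (t : R) (d : C) :
  cvder g t d -> is_derive (fun t => Cmod (g t) ^ 2) t (2 * Re (Cconj (g t) * d)%C).
Proof.
intros [H1 H2].
apply (is_derive_ext (fun t => Re (g t) ^ 2 + Im (g t) ^ 2)).
{ intros s; symmetry; apply Cmod2_alt. }
evar_last.
{ apply (is_derive_plus (K := R_AbsRing) (V := R_NormedModule)); apply is_derive_pow; eauto. }
unfold Re, Im, plus; simpl; ring.
Qed.

(** The function [y t * exp (- K * t)] has nonpositive derivative. *)
Lemma gronwall (y y' : R -> R) (K : R) :
  (forall t, 0 <= t <= 1 -> is_derive y t (y' t)) ->
  (forall t, 0 <= t <= 1 -> y' t <= K * y t) -> y 1 <= exp K * y 0.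
Proof.
intros Hd Hb.
set (w' := fun t => (y' t - K * y t) * exp (- K * t)).
assert (D : forall t, 0 <= t <= 1 -> is_derive (fun t => y t * exp (- K * t)) t (w' t)).
{ intros t Ht; unfold w'; evar_last.
  { apply (is_derive_mult (K := R_AbsRing)); [now apply Hd| |intros; apply Rmult_comm].
    instantiate (1 := - K * exp (- K * t)); auto_derive; trivial; ring. }
  unfold plus, mult; simpl; ring. }
destruct (MVT_gen (fun t => y t * exp (- K * t)) 0 1 w') as [c [Hc E]].
- intros t Ht; rewrite Rmin_left, Rmax_right in Ht by lra; apply D; lra.
- intros t Ht; rewrite Rmin_left, Rmax_right in Ht by lra.
  apply continuity_pt_filterlim.
  apply (ex_derive_continuous (K := R_AbsRing) (V := R_NormedModule)
    (fun t => y t * exp (- K * t)) t).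
  exists (w' t); now apply D.
- rewrite Rmin_left, Rmax_right in Hc by lra.
  cbv beta in E; rewrite Rmult_0_r, exp_0, !Rmult_1_r in E.
  assert (Hw : w' c <= 0).
  { unfold w'; specialize (Hb c Hc); pose proof (exp_pos (- K * c)); nra. }
  rewrite exp_Ropp in E; pose proof (exp_pos K) as PK.
  apply (Rmult_le_reg_r (/ exp K)); [now apply Rinv_0_lt_compat|].
  replace (exp K * y 0 * / exp K) with (y 0) by (field; lra). lra.
Qed.

(** The triangle [j + k <= p] is padded with zeros to a square, so that the lemmas on [dsq]
    apply. *)
Definition energy (p : nat) (g : nat -> nat -> R) : R :=
  dsq (G := R_AbelianMonoid) (fun j k => if (j + k <=? p)%nat then g j k ^ 2 else 0) p.

Lemma energy_term_nonneg (p : nat) (g : nat -> nat -> R) (j k : nat) :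
  0 <= (if (j + k <=? p)%nat then g j k ^ 2 else 0).
Proof. destruct (j + k <=? p)%nat; [apply pow2_ge_0|lra]. Qed.

Lemma energy_ge (p : nat) (g : nat -> nat -> R) (j k : nat) :
  (j + k <= p)%nat -> g j k ^ 2 <= energy p g.
Proof.
intros H.
pose proof (term_le_dsq (fun j k => if (j + k <=? p)%nat then g j k ^ 2 else 0) j k p
  (energy_term_nonneg p g) ltac:(lia) ltac:(lia)) as T.
cbv beta in T; now rewrite (proj2 (Nat.leb_le _ _) H) in T.
Qed.

Lemma energy_le (p : nat) (g : nat -> nat -> R) (B : R) :
  (forall j k, (j + k <= p)%nat -> 0 <= g j k <= B) -> energy p g <= (INR (S p) * B) ^ 2.
Proof.
intros H.
assert (HB : 0 <= B) by (destruct (H 0%nat 0%nat ltac:(lia)); lra).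
replace ((INR (S p) * B) ^ 2) with (INR (S p) ^ 2 * B ^ 2) by ring.
rewrite <- dsq_const; apply dsq_le; intros j k.
destruct (Nat.leb_spec (j + k) p) as [Hp|_]; [|apply pow2_ge_0].
now apply pow_incr, H.
Qed.

(** With [En] the energy, [|g|^2 <= En] and [|d|^2 <= K^2 * En], so each term has derivative at most
    [2 * |g| * |d| <= 2 * K * En]. The [(p + 1)^2] entries of the square give the rate for
    [gronwall]. *)
Lemma energy_growth (p : nat) (g d : nat -> nat -> R -> C) (K : R) :
  0 <= K ->
  (forall t j k, 0 <= t <= 1 -> (j + k <= p)%nat -> cvder (g j k) t (d j k t)) ->
  (forall t j k, 0 <= t <= 1 -> (j + k <= p)%nat ->
    Cmod (d j k t) ^ 2 <= K ^ 2 * energy p (fun j k => Cmod (g j k t))) ->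
  energy p (fun j k => Cmod (g j k 1)) <=
    exp (2 * K * INR (S p) ^ 2) * energy p (fun j k => Cmod (g j k 0)).
Proof.
intros HK Hd Hb.
apply (gronwall (fun t => energy p (fun j k => Cmod (g j k t)))
  (fun t => dsq (G := R_AbelianMonoid) (fun j k => if (j + k <=? p)%nat
     then 2 * Re (Cconj (g j k t) * d j k t)%C else 0) p)).
- intros t Ht; unfold energy.
  apply (is_derive_dsq (fun j k t => if (j + k <=? p)%nat then Cmod (g j k t) ^ 2 else 0)).
  intros j k; destruct (Nat.leb_spec (j + k) p) as [Hp|_].
  + now apply is_derive_Cmod2, Hd.
  + apply (is_derive_const (K := R_AbsRing) (V := R_NormedModule)).
- intros t Ht; set (En := energy p (fun j k => Cmod (g j k t))).
  assert (HE : 0 <= En).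
  { eapply Rle_trans; [|apply (energy_ge p _ 0 0); lia]; apply pow2_ge_0. }
  replace (2 * K * INR (S p) ^ 2 * En) with (INR (S p) ^ 2 * (2 * (K * En))) by ring.
  rewrite <- dsq_const; apply dsq_le; intros j k.
  destruct (Nat.leb_spec (j + k) p) as [Hp|_]; [|nra].
  apply Rmult_le_compat_l; [lra|].
  eapply Rle_trans; [apply Rle_abs|]; eapply Rle_trans; [apply re_le_Cmod|].
  rewrite Cmod_mult, Cmod_conj.
  pose proof (energy_ge p (fun j k => Cmod (g j k t)) j k Hp) as T1; fold En in T1.
  pose proof (Hb t j k Ht Hp) as T2; fold En in T2.
  pose proof (Cmod_ge_0 (g j k t)); pose proof (Cmod_ge_0 (d j k t)).
  apply Rsqr_incr_0; [|nra|nra].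
  unfold Rsqr.
  replace (Cmod (g j k t) * Cmod (d j k t) * (Cmod (g j k t) * Cmod (d j k t)))
    with (Cmod (g j k t) ^ 2 * Cmod (d j k t) ^ 2) by ring.
  replace (K * En * (K * En)) with (En * (K ^ 2 * En)) by ring.
  apply Rmult_le_compat; try easy; apply pow2_ge_0.
Qed.

(** * Finite maxima and factorials *)

Lemma fold_Rmax_ge (l : list R) (x : R) : In x l -> x <= fold_right Rmax 0 l.
Proof.
induction l as [|y l IH]; simpl; [easy|intros [->|H]]; [apply Rmax_l|].
eapply Rle_trans; [now apply IH|apply Rmax_r].
Qed.

(** The fold starts from 0, so a bound must be nonnegative besides dominating the list. *)
Lemma fold_Rmax_le (l : list R) (B : R) :
  0 <= B -> (forall x, In x l -> x <= B) -> fold_right Rmax 0 l <= B.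
Proof.
intros HB; induction l as [|y l IH]; simpl; intros H; [easy|].
apply Rmax_lub; auto.
Qed.

Lemma fold_Rmax_nonneg (l : list R) : 0 <= fold_right Rmax 0 l.
Proof.
induction l as [|y l IH]; simpl; [lra|]. eapply Rle_trans; [apply IH|apply Rmax_r].
Qed.

Lemma max_eq_ge (g : nat -> nat -> R) (s i j : nat) : (i + j)%nat = s -> g i j <= max_eq s g.
Proof.
intros <-; apply fold_Rmax_ge, in_map_iff; exists i; split.
- f_equal; lia.
- apply in_seq; lia.
Qed.

Lemma max_eq_lub (g : nat -> nat -> R) (s : nat) (B : R) :
  0 <= B -> (forall i j, (i + j)%nat = s -> g i j <= B) -> max_eq s g <= B.
Proof.
intros HB H; apply fold_Rmax_le; [easy|]; intros x Hx.
apply in_map_iff in Hx; destruct Hx as [i [<- Hi]]; apply in_seq in Hi.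
apply H; lia.
Qed.

Lemma max_le_ge (g : nat -> nat -> R) (n i j : nat) : (i + j <= n)%nat -> g i j <= max_le n g.
Proof.
intros H; eapply Rle_trans; [now apply (max_eq_ge g (i + j))|].
apply fold_Rmax_ge, in_map_iff; exists (i + j)%nat; split; [easy|apply in_seq; lia].
Qed.

Lemma max_le_nonneg (g : nat -> nat -> R) (n : nat) : 0 <= max_le n g.
Proof. apply fold_Rmax_nonneg. Qed.

Lemma max_le_lub (g : nat -> nat -> R) (n : nat) (B : R) :
  0 <= B -> (forall i j, (i + j <= n)%nat -> g i j <= B) -> max_le n g <= B.
Proof.
intros HB H; apply fold_Rmax_le; [easy|]; intros x Hx.
apply in_map_iff in Hx; destruct Hx as [s [<- Hs]]; apply in_seq in Hs.
apply max_eq_lub; [easy|]; intros i j E; apply H; lia.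
Qed.

Lemma fact_INR_ge_1 (n : nat) : 1 <= INR (Factorial.fact n).
Proof. apply (le_INR 1), lt_O_fact. Qed.

Lemma fact_INR_le (m n : nat) : (m <= n)%nat -> INR (Factorial.fact m) <= INR (Factorial.fact n).
Proof. intros H; now apply le_INR, fact_le. Qed.

(** * Comparison of weights and the index *)

Lemma nf_idx_term (F : C * C -> C) (l1 l2 : C * C -> R) (z : C * C) (j k : nat) :
  nf_term F l1 l2 z j k =
  INR (Factorial.fact j) * INR (Factorial.fact k) * idx_term F l1 l2 z j k.
Proof.
unfold nf_term, idx_term.
set (X := l1 z ^ j * l2 z ^ k).
set (f := INR (Factorial.fact j) * INR (Factorial.fact k)).
assert (Hf : f <> 0) by (apply Rmult_integral_contrapositive; split; apply INR_fact_neq_0).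
replace (f * l1 z ^ j * l2 z ^ k) with (f * X) by (unfold X; ring).
unfold Rdiv; rewrite Rinv_mult.
replace (f * (Cmod (pderiv F j k z) * (/ f * / X))) with
  (f * / f * (Cmod (pderiv F j k z) * / X)) by ring.
rewrite Rinv_r by easy; ring.
Qed.

Lemma idx_term_nonneg (F : C * C -> C) (l1 l2 : C * C -> R) (z : C * C) (j k : nat) :
  0 < l1 z -> 0 < l2 z -> 0 <= idx_term F l1 l2 z j k.
Proof.
intros H1 H2; apply Rmult_le_pos; [apply Cmod_ge_0|left; apply Rinv_0_lt_compat].
repeat apply Rmult_lt_0_compat; try apply INR_fact_lt_0; now apply pow_lt.
Qed.

Lemma nf_term_nonneg (F : C * C -> C) (l1 l2 : C * C -> R) (z : C * C) (j k : nat) :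
  0 < l1 z -> 0 < l2 z -> 0 <= nf_term F l1 l2 z j k.
Proof.
intros H1 H2; apply Rmult_le_pos; [apply Cmod_ge_0|left; apply Rinv_0_lt_compat].
apply Rmult_lt_0_compat; now apply pow_lt.
Qed.

Lemma idx_le_nf (F : C * C -> C) (l1 l2 : C * C -> R) (z : C * C) (j k : nat) :
  0 < l1 z -> 0 < l2 z -> idx_term F l1 l2 z j k <= nf_term F l1 l2 z j k.
Proof.
intros H1 H2; rewrite nf_idx_term.
pose proof (idx_term_nonneg F l1 l2 z j k H1 H2).
pose proof (fact_INR_ge_1 j); pose proof (fact_INR_ge_1 k).
assert (1 <= INR (Factorial.fact j) * INR (Factorial.fact k)) by nra. nra.
Qed.

Lemma nf_le_idx (F : C * C -> C) (l1 l2 : C * C -> R) (z : C * C) (n j k : nat) :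
  0 < l1 z -> 0 < l2 z -> (j + k <= n)%nat ->
  nf_term F l1 l2 z j k <= INR (Factorial.fact n) ^ 2 * idx_term F l1 l2 z j k.
Proof.
intros H1 H2 Hn; rewrite nf_idx_term.
pose proof (fact_INR_ge_1 j); pose proof (fact_INR_ge_1 k).
apply Rmult_le_compat_r; [now apply idx_term_nonneg|].
replace (INR (Factorial.fact n) ^ 2) with
  (INR (Factorial.fact n) * INR (Factorial.fact n)) by ring.
apply Rmult_le_compat; try lra; apply fact_INR_le; lia.
Qed.

Lemma bounded_index_bounds_next_order (F : C * C -> C) (l1 l2 : C * C -> R) :
  (forall z, in_D2 z -> 0 < l1 z /\ 0 < l2 z) ->
  bounded_L_index F l1 l2 ->
  exists (p : nat) (c : R), 0 <= c /\ forall z, in_D2 z ->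
    max_eq (S p) (nf_term F l1 l2 z) <= c * max_le p (nf_term F l1 l2 z).
Proof.
intros Hpos [n0 H]; exists n0, (INR (Factorial.fact (S n0)) ^ 2).
split; [apply pow2_ge_0|]; intros z Hz; destruct (Hpos z Hz) as [H1 H2].
apply max_eq_lub.
- apply Rmult_le_pos; [apply pow2_ge_0|apply max_le_nonneg].
- intros i j Hij.
  eapply Rle_trans; [apply (nf_le_idx _ _ _ _ (S n0)); try easy; lia|].
  apply Rmult_le_compat_l; [apply pow2_ge_0|].
  eapply Rle_trans; [now apply H|].
  apply max_le_lub; [apply max_le_nonneg|]; intros i' j' Hij'.
  eapply Rle_trans; [now apply idx_le_nf|now apply max_le_ge].
Qed.

(** * Energy with frozen weights *)

Lemma energy_ext (p : nat) (g h : nat -> nat -> R) :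
  (forall j k, g j k = h j k) -> energy p g = energy p h.
Proof.
intros E; unfold energy, dsq; apply sum_n_ext; intros j; apply sum_n_ext; intros k.
now rewrite E.
Qed.

Lemma cvder_line (a v : C) (t : R) : cvder (fun t => a + RtoC t * v)%C t v.
Proof.
destruct a, v; split; unfold RtoC, Re, Im; simpl; auto_derive; trivial; ring.
Qed.

(** The pair [(dj, dk)] is [(1, 0)] or [(0, 1)], the direction of the segment. *)
Lemma energy_segment (F : C * C -> C) (L1 L2 K beta : R) (p dj dk : nat)
  (z : R -> C * C) (v : C) :
  0 < L1 -> 0 < L2 -> 0 <= K -> 0 <= beta ->
  (dj + dk)%nat = 1%nat -> Cmod v * (L1 ^ dj * L2 ^ dk) <= beta ->
  (forall t j k, 0 <= t <= 1 ->
    cvder (fun t => pderiv F j k (z t)) t (pderiv F (dj + j) (dk + k) (z t) * v)%C) ->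
  (forall t j k, 0 <= t <= 1 -> (j + k <= S p)%nat ->
    nf_term F (fun _ => L1) (fun _ => L2) (z t) j k ^ 2 <=
    K ^ 2 * energy p (nf_term F (fun _ => L1) (fun _ => L2) (z t))) ->
  energy p (nf_term F (fun _ => L1) (fun _ => L2) (z 1)) <=
  exp (2 * (beta * K) * INR (S p) ^ 2) *
    energy p (nf_term F (fun _ => L1) (fun _ => L2) (z 0)).
Proof.
intros HL1 HL2 HK Hbeta Hdir Hv Hd Hb.
set (T := fun t => nf_term F (fun _ => L1) (fun _ => L2) (z t)) in *.
set (g := fun j k t => (pderiv F j k (z t) * RtoC (/ (L1 ^ j * L2 ^ k)))%C).
assert (HX : forall j k, 0 < / (L1 ^ j * L2 ^ k)).
{ intros j k; apply Rinv_0_lt_compat, Rmult_lt_0_compat; now apply pow_lt. }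
assert (Eg : forall t j k, Cmod (g j k t) = T t j k).
{ intros t j k; unfold g, T, nf_term.
  rewrite Cmod_mult, Cmod_R, Rabs_pos_eq; [reflexivity|left; apply HX]. }
pose proof (energy_growth p g (fun j k t => (pderiv F (dj + j) (dk + k) (z t) * v
  * RtoC (/ (L1 ^ j * L2 ^ k)))%C) (beta * K)) as G.
rewrite (energy_ext p _ _ (Eg 1)), (energy_ext p _ _ (Eg 0)) in G.
apply G; clear G; [now apply Rmult_le_pos| |].
- intros t j k Ht _.
  replace (pderiv F (dj + j) (dk + k) (z t) * v * RtoC (/ (L1 ^ j * L2 ^ k)))%C with
    (pderiv F (dj + j) (dk + k) (z t) * v * RtoC (/ (L1 ^ j * L2 ^ k)) +
      pderiv F j k (z t) * RtoC 0)%C by ring.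
  apply (cvder_mult (fun t => pderiv F j k (z t)) (fun _ => RtoC (/ (L1 ^ j * L2 ^ k))));
    [now apply Hd|].
  split; apply (is_derive_const (K := R_AbsRing) (V := R_NormedModule)).
- intros t j k Ht Hjk; rewrite (energy_ext p _ _ (Eg t)).
  specialize (Hb t (dj + j)%nat (dk + k)%nat Ht ltac:(lia)).
  fold (T t) in Hb.
  (* The derivative has order one higher but still the weight of order [(j, k)]; the missing power
     of [L1] or [L2], multiplied by the length of [v], is at most [beta]. *)
  assert (E : Cmod (pderiv F (dj + j) (dk + k) (z t) * v * RtoC (/ (L1 ^ j * L2 ^ k)))%C
    = T t (dj + j)%nat (dk + k)%nat * (Cmod v * (L1 ^ dj * L2 ^ dk))).
  { rewrite !Cmod_mult, Cmod_R, Rabs_pos_eq by (left; apply HX).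
    unfold T, nf_term; rewrite !pow_add; field.
    repeat split; apply pow_nonzero; lra. }
  rewrite E, (Rpow_mult_distr (T t _ _)), (Rpow_mult_distr beta K).
  rewrite (Rmult_comm (T t _ _ ^ 2)), Rmult_assoc.
  apply Rmult_le_compat; try apply pow2_ge_0; [|exact Hb].
  apply pow_incr; split; [|easy].
  apply Rmult_le_pos; [apply Cmod_ge_0|apply Rmult_le_pos; apply pow_le; lra].
Qed.

Lemma pow_ratio_le (x y m : R) (j n : nat) :
  0 < x -> 0 < y -> 1 <= m -> x <= m * y -> (j <= n)%nat -> / y ^ j <= m ^ n * / x ^ j.
Proof.
intros Hx Hy Hm H Hj.
pose proof (pow_lt x j Hx); pose proof (pow_lt y j Hy).
apply (Rmult_le_reg_r (x ^ j * y ^ j)); [nra|].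
replace (/ y ^ j * (x ^ j * y ^ j)) with (x ^ j) by (field; lra).
replace (m ^ n * / x ^ j * (x ^ j * y ^ j)) with (m ^ n * y ^ j) by (field; lra).
apply Rle_trans with ((m * y) ^ j); [apply pow_incr; lra|].
rewrite Rpow_mult_distr; apply Rmult_le_compat_r; [lra|now apply Rle_pow].
Qed.

Lemma nf_term_ratio_le (F : C * C -> C) (l1 l2 k1 k2 : C * C -> R) (m : R) (z : C * C)
  (j k n : nat) :
  0 < l1 z -> 0 < l2 z -> 0 < k1 z -> 0 < k2 z -> 1 <= m ->
  k1 z <= m * l1 z -> k2 z <= m * l2 z -> (j + k <= n)%nat ->
  nf_term F l1 l2 z j k <= m ^ n * m ^ n * nf_term F k1 k2 z j k.
Proof.
intros P1 P2 Q1 Q2 Hm H1 H2 Hn; unfold nf_term, Rdiv; rewrite !Rinv_mult.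
pose proof (pow_ratio_le (k1 z) (l1 z) m j n Q1 P1 Hm H1 ltac:(lia)) as R1.
pose proof (pow_ratio_le (k2 z) (l2 z) m k n Q2 P2 Hm H2 ltac:(lia)) as R2.
pose proof (pow_lt (l1 z) j P1) as X1; pose proof (pow_lt (l2 z) k P2) as X2.
apply Rinv_0_lt_compat in X1; apply Rinv_0_lt_compat in X2.
replace (m ^ n * m ^ n * (Cmod (pderiv F j k z) * (/ k1 z ^ j * / k2 z ^ k))) with
  (Cmod (pderiv F j k z) * ((m ^ n * / k1 z ^ j) * (m ^ n * / k2 z ^ k))) by ring.
apply Rmult_le_compat_l; [apply Cmod_ge_0|].
apply Rmult_le_compat; lra.
Qed.

(** At order [p + 1], passing from frozen to running weights costs [m ^ S p] per variable, the
    hypothesis costs [c], and returning at order at most [p] costs [m ^ p] per variable. The summand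
    1 covers the orders at most [p], whose terms are entries of the energy. *)
Lemma frozen_derivative_bound (F : C * C -> C) (l1 l2 : C * C -> R) (L1 L2 m c : R) (p : nat)
  (z : C * C) :
  0 < l1 z -> 0 < l2 z -> 0 < L1 -> 0 < L2 -> 1 <= m -> 0 <= c ->
  l1 z <= m * L1 -> l2 z <= m * L2 -> L1 <= m * l1 z -> L2 <= m * l2 z ->
  max_eq (S p) (nf_term F l1 l2 z) <= c * max_le p (nf_term F l1 l2 z) ->
  forall j k, (j + k <= S p)%nat ->
    nf_term F (fun _ => L1) (fun _ => L2) z j k ^ 2 <=
    (1 + m ^ S p * m ^ S p * (c * (m ^ p * m ^ p))) ^ 2 *
      energy p (nf_term F (fun _ => L1) (fun _ => L2) z).
Proof.
intros P1 P2 Q1 Q2 Hm Hc A1 A2 B1 B2 H j k Hjk.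
set (T := nf_term F (fun _ => L1) (fun _ => L2) z).
set (E := energy p T).
assert (HT : forall j k, 0 <= T j k) by (intros; now apply nf_term_nonneg).
assert (HE : 0 <= E).
{ eapply Rle_trans; [|apply (energy_ge p T 0 0); lia]; apply pow2_ge_0. }
assert (Hm1 : 0 <= m ^ S p * m ^ S p) by (apply Rmult_le_pos; apply pow_le; lra).
assert (Hm2 : 0 <= m ^ p * m ^ p) by (apply Rmult_le_pos; apply pow_le; lra).
assert (HQ : 0 <= m ^ S p * m ^ S p * (c * (m ^ p * m ^ p)))
  by (apply Rmult_le_pos; [easy|now apply Rmult_le_pos]).
set (Q := m ^ S p * m ^ S p * (c * (m ^ p * m ^ p))) in *.
assert (Hsq : forall j k, (j + k <= p)%nat -> T j k <= sqrt E).
{ intros i i' Hi; rewrite <- (sqrt_pow2 (T i i')) by apply HT.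
  now apply sqrt_le_1_alt, energy_ge. }
pose proof (sqrt_pos E) as HsE.
assert (HTE : T j k <= (1 + Q) * sqrt E).
{ destruct (Nat.eq_dec (j + k) (S p)) as [Es|Hne].
  - apply Rle_trans with (Q * sqrt E); [|nra].
    eapply Rle_trans.
    { now apply (nf_term_ratio_le F (fun _ => L1) (fun _ => L2) l1 l2 m z j k (S p)). }
    unfold Q; rewrite !(Rmult_assoc (m ^ S p * m ^ S p)), (Rmult_assoc c).
    apply Rmult_le_compat_l; [easy|].
    eapply Rle_trans; [now apply (max_eq_ge _ (S p))|].
    eapply Rle_trans; [apply H|]; apply Rmult_le_compat_l; [easy|].
    apply max_le_lub; [now apply Rmult_le_pos|]; intros i i' Hi.
    eapply Rle_trans.
    { now apply (nf_term_ratio_le F l1 l2 (fun _ => L1) (fun _ => L2) m z i i' p). }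
    apply Rmult_le_compat_l; [easy|now apply Hsq].
  - specialize (Hsq j k ltac:(lia)); nra. }
replace ((1 + Q) ^ 2 * E) with (((1 + Q) * sqrt E) ^ 2)
  by (rewrite Rpow_mult_distr, pow2_sqrt; easy).
apply pow_incr; split; [apply HT|easy].
Qed.

(** This keeps the closed disc of radius [beta / L] around [a] inside the unit disc, with the strict
    room that Cauchy's estimate needs. *)
Lemma radius_lt (a : C) (L beta : R) :
  0 < beta -> Cmod a < 1 -> beta / (1 - Cmod a) < L ->
  0 < L /\ beta / L < 1 - Cmod a.
Proof.
intros Hb Ha HL.
assert (H0 : 0 < beta / (1 - Cmod a)) by (apply Rdiv_lt_0_compat; lra).
split; [lra|].
apply (Rmult_lt_reg_r L); [lra|].
replace (beta / L * L) with beta by (field; lra).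
replace beta with (beta / (1 - Cmod a) * (1 - Cmod a)) by (field; lra).
rewrite Rmult_comm; apply Rmult_lt_compat_l; lra.
Qed.

(** * From growth on a polydisc to the index bound *)

(** The one-variable estimate in [y] bounds the [k]-th derivative of [F] on the slice [y = b], and
    this is the bound that the estimate in [x] takes as input. *)
Lemma cauchy_estimate_D2 (F : C * C -> C) (a b : C) (r1 r2 B : R) (j k : nat) :
  analytic_D2 F ->
  0 < r1 < 1 - Cmod a -> 0 < r2 < 1 - Cmod b ->
  (forall x y, Cmod (x - a)%C <= r1 -> Cmod (y - b)%C <= r2 -> Cmod (F (x, y)) <= B) ->
  Cmod (pderiv F j k (a, b)) <=
  INR (Factorial.fact j) / r1 ^ j * (INR (Factorial.fact k) / r2 ^ k * B).
Proof.
intros HF Hr1 Hr2 HB.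
apply (cauchy_estimate (fun n x => pderiv F n k (x, b)) a (1 - Cmod a) r1); [|easy|].
- intros n x Hx; apply pderiv_cder; [easy|].
  pose proof (Cmod_shift x a); split; simpl; lra.
- intros x Hx.
  apply (cauchy_estimate (fun n y => pderiv F 0 n (x, y)) b (1 - Cmod b) r2); [|easy|].
  + intros n y Hy; apply pderiv_cder; [easy|].
    pose proof (Cmod_shift x a); pose proof (Cmod_shift y b); split; simpl; lra.
  + intros y Hy; now apply HB.
Qed.

Lemma polydisc_growth (F : C * C -> C) (L1 L2 K beta : R) (p : nat) (a b : C) :
  analytic_D2 F -> 0 < beta -> 0 <= K -> 0 < L1 -> 0 < L2 ->
  beta / L1 < 1 - Cmod a -> beta / L2 < 1 - Cmod b ->
  (forall x y j k, Cmod (x - a)%C <= beta / L1 -> Cmod (y - b)%C <= beta / L2 ->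
    (j + k <= S p)%nat ->
    nf_term F (fun _ => L1) (fun _ => L2) (x, y) j k ^ 2 <=
    K ^ 2 * energy p (nf_term F (fun _ => L1) (fun _ => L2) (x, y))) ->
  forall x y, Cmod (x - a)%C <= beta / L1 -> Cmod (y - b)%C <= beta / L2 ->
    energy p (nf_term F (fun _ => L1) (fun _ => L2) (x, y)) <=
    exp (2 * (beta * K) * INR (S p) ^ 2) ^ 2 *
      energy p (nf_term F (fun _ => L1) (fun _ => L2) (a, b)).
Proof.
intros HF Hbeta HK HL1 HL2 Ha Hb H x y Hx Hy.
set (kappa := exp (2 * (beta * K) * INR (S p) ^ 2)).
assert (Hpath : forall c w r t, Cmod (w - c)%C <= r -> 0 <= t <= 1 ->
  Cmod (c + RtoC t * (w - c) - c)%C <= r).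
{ intros c w r t Hw Ht.
  replace (c + RtoC t * (w - c) - c)%C with (RtoC t * (w - c))%C by ring.
  rewrite Cmod_mult, Cmod_R, Rabs_pos_eq by lra.
  pose proof (Cmod_ge_0 (w - c)%C); nra. }
assert (Hend : forall c w, (c + RtoC 1 * (w - c))%C = w) by (intros; ring).
assert (Hstart : forall c w, (c + RtoC 0 * (w - c))%C = c) by (intros; ring).
assert (Hscale : forall u L, 0 < L -> u <= beta / L -> u * L <= beta).
{ intros u L HL Hu; replace beta with (beta / L * L) by (field; lra).
  apply Rmult_le_compat_r; lra. }
assert (Z : Cmod (b - b)%C <= beta / L2).
{ replace (b - b)%C with (RtoC 0) by ring; rewrite Cmod_0.
  left; now apply Rdiv_lt_0_compat. }
assert (Hin : forall x y, Cmod (x - a)%C <= beta / L1 -> Cmod (y - b)%C <= beta / L2 ->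
  in_D2 (x, y)).
{ intros x' y' Hx' Hy'; pose proof (Cmod_shift x' a); pose proof (Cmod_shift y' b).
  split; simpl; lra. }
(* The path turns at the corner [(x, b)]; each of its two segments costs one factor [kappa]. *)
assert (S1 := energy_segment F L1 L2 K beta p 1 0 (fun t => ((a + RtoC t * (x - a))%C, b))
  (x - a)%C HL1 HL2 HK (Rlt_le _ _ Hbeta) eq_refl).
assert (S2 := energy_segment F L1 L2 K beta p 0 1 (fun t => (x, (b + RtoC t * (y - b))%C))
  (y - b)%C HL1 HL2 HK (Rlt_le _ _ Hbeta) eq_refl).
cbv beta in S1, S2; rewrite Hend, Hstart in S1, S2; fold kappa in S1, S2.
apply Rle_trans with (kappa * energy p (nf_term F (fun _ => L1) (fun _ => L2) (x, b))).
- apply S2.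
  + rewrite pow_O, pow_1, Rmult_1_l; now apply Hscale.
  + intros t j k Ht.
    apply (cvder_cder (fun w => pderiv F j k (x, w)) (fun t => b + RtoC t * (y - b))%C);
      [|apply cvder_line].
    now apply pderiv_cder; [|apply Hin; [|apply Hpath]].
  + intros t j k Ht Hjk; apply H; try easy; now apply Hpath.
- replace (kappa ^ 2) with (kappa * kappa) by ring; rewrite Rmult_assoc.
  apply Rmult_le_compat_l; [left; apply exp_pos|].
  apply S1.
  + rewrite pow_O, pow_1, Rmult_1_r; now apply Hscale.
  + intros t j k Ht.
    apply (cvder_cder (fun w => pderiv F j k (w, b)) (fun t => a + RtoC t * (x - a))%C);
      [|apply cvder_line].
    now apply pderiv_cder; [|apply Hin; [apply Hpath|]].
  + intros t j k Ht Hjk; apply H; try easy; now apply Hpath.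
Qed.

(** With radii [beta / l_j] the weights in Cauchy's estimate cancel those of [idx_term], which
    leaves the power of [/ beta]. The bound on [F] itself is read off the entry of orders [(0, 0)]
    of the energy. *)
Lemma idx_term_decay (F : C * C -> C) (l1 l2 : C * C -> R) (K beta : R) (p : nat) (z : C * C) :
  analytic_D2 F -> 0 < beta -> 0 <= K -> 0 < l1 z -> 0 < l2 z ->
  beta / l1 z < 1 - Cmod (fst z) -> beta / l2 z < 1 - Cmod (snd z) ->
  (forall x y j k, Cmod (x - fst z)%C <= beta / l1 z -> Cmod (y - snd z)%C <= beta / l2 z ->
    (j + k <= S p)%nat ->
    nf_term F (fun _ => l1 z) (fun _ => l2 z) (x, y) j k ^ 2 <=
    K ^ 2 * energy p (nf_term F (fun _ => l1 z) (fun _ => l2 z) (x, y))) ->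
  forall j k, idx_term F l1 l2 z j k <= (/ beta) ^ (j + k) *
    (exp (2 * (beta * K) * INR (S p) ^ 2) *
      (INR (S p) * (INR (Factorial.fact p) ^ 2 * max_le p (idx_term F l1 l2 z)))).
Proof.
destruct z as [a b]; cbn [fst snd].
set (z := (a, b)); set (L1 := l1 z); set (L2 := l2 z).
intros HF Hbeta HK HL1 HL2 Ha Hb H j k.
set (kappa := exp (2 * (beta * K) * INR (S p) ^ 2)).
set (N := INR (S p) * (INR (Factorial.fact p) ^ 2 * max_le p (idx_term F l1 l2 z))).
set (T := nf_term F (fun _ => L1) (fun _ => L2)).
assert (HN : energy p (T z) <= N ^ 2).
{ apply energy_le; intros i i' Hi; split; [now apply nf_term_nonneg|].
  eapply Rle_trans; [now apply (nf_le_idx F l1 l2 z p)|].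
  apply Rmult_le_compat_l; [apply pow2_ge_0|now apply max_le_ge]. }
assert (HN0 : 0 <= N).
{ apply Rmult_le_pos; [apply pos_INR|].
  apply Rmult_le_pos; [apply pow2_ge_0|apply max_le_nonneg]. }
assert (Hkap : 0 < kappa) by apply exp_pos.
assert (HB : forall x y, Cmod (x - a)%C <= beta / L1 -> Cmod (y - b)%C <= beta / L2 ->
  Cmod (F (x, y)) <= kappa * N).
{ intros x y Hx Hy.
  pose proof (polydisc_growth F L1 L2 K beta p a b HF Hbeta HK HL1 HL2 Ha Hb H x y Hx Hy) as G.
  fold kappa T z in G.
  pose proof (energy_ge p (T (x, y)) 0 0 ltac:(lia)) as G0.
  replace (T (x, y) 0%nat 0%nat) with (Cmod (F (x, y))) in G0
    by (unfold T, nf_term; simpl; field).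
  apply Rsqr_incr_0; [|apply Cmod_ge_0|nra].
  unfold Rsqr.
  assert (kappa ^ 2 * energy p (T z) <= kappa ^ 2 * N ^ 2)
    by (apply Rmult_le_compat_l; [apply pow2_ge_0|easy]).
  lra. }
assert (P1 : 0 < beta / L1) by now apply Rdiv_lt_0_compat.
assert (P2 : 0 < beta / L2) by now apply Rdiv_lt_0_compat.
pose proof (cauchy_estimate_D2 F a b (beta / L1) (beta / L2) (kappa * N) j k HF
  (conj P1 Ha) (conj P2 Hb) HB) as Cest.
pose proof (INR_fact_lt_0 j); pose proof (INR_fact_lt_0 k).
pose proof (pow_lt L1 j HL1); pose proof (pow_lt L2 k HL2).
unfold idx_term; fold z L1 L2.
set (D := INR (Factorial.fact j) * INR (Factorial.fact k) * L1 ^ j * L2 ^ k).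
assert (HD : 0 < D) by (unfold D; repeat apply Rmult_lt_0_compat; lra).
apply (Rmult_le_reg_r D); [easy|].
unfold Rdiv at 1; rewrite Rmult_assoc, Rinv_l, Rmult_1_r by lra.
eapply Rle_trans; [exact Cest|]; right.
unfold Rdiv; rewrite !Rpow_mult_distr, !pow_inv, pow_add.
unfold D; field; repeat split; try (apply pow_nonzero; lra); lra.
Qed.

Lemma next_order_bound_bounds_index (beta : R) (l1 l2 : C * C -> R) (F : C * C -> C)
  (p : nat) (c : R) :
  1 < beta -> admissible_L beta l1 l2 -> in_Q2 beta l1 l2 -> analytic_D2 F -> 0 <= c ->
  (forall z, in_D2 z ->
    max_eq (S p) (nf_term F l1 l2 z) <= c * max_le p (nf_term F l1 l2 z)) ->
  bounded_L_index F l1 l2.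
Proof.
intros Hbeta [_ HL] HQ HF Hc H.
destruct (HQ beta beta ltac:(lra) ltac:(lra))
  as [[[c1 [Hc1 K1]] [M1 N1]] [[c2 [Hc2 K2]] [M2 N2]]].
(* One ratio for both weights and both directions: [M1], [M2] bound the quotients, [/ c1], [/ c2]
   their inverses. Being at least 1, its powers grow with the exponent. *)
set (m := Rmax 1 (Rmax (Rmax M1 (/ c1)) (Rmax M2 (/ c2)))).
assert (Hm : 1 <= m) by apply Rmax_l.
assert (Hmm : Rmax (Rmax M1 (/ c1)) (Rmax M2 (/ c2)) <= m) by apply Rmax_r.
pose proof (Rmax_l (Rmax M1 (/ c1)) (Rmax M2 (/ c2))).
pose proof (Rmax_r (Rmax M1 (/ c1)) (Rmax M2 (/ c2))).
pose proof (Rmax_l M1 (/ c1)); pose proof (Rmax_r M1 (/ c1)).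
pose proof (Rmax_l M2 (/ c2)); pose proof (Rmax_r M2 (/ c2)).
assert (Hratio : forall x y c' M' , 0 < x -> 0 < y -> 0 < c' -> M' <= m -> / c' <= m ->
  c' <= x / y -> x / y <= M' -> x <= m * y /\ y <= m * x).
{ intros x y c' M' Hx Hy Hc' HM Hi Hlo Hhi.
  assert (E : x = x / y * y) by (field; lra).
  split; [rewrite E at 1; apply Rmult_le_compat_r; lra|].
  apply Rle_trans with (/ c' * x); [|apply Rmult_le_compat_r; lra].
  apply (Rmult_le_reg_l c'); [easy|].
  rewrite <- Rmult_assoc, Rinv_r, Rmult_1_l by lra.
  rewrite E; apply Rmult_le_compat_r; lra. }
set (K := 1 + m ^ S p * m ^ S p * (c * (m ^ p * m ^ p))).
assert (HK : 0 <= K).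
{ assert (0 <= m ^ p * m ^ p) by (apply Rmult_le_pos; apply pow_le; lra).
  assert (0 <= m ^ S p * m ^ S p) by (apply Rmult_le_pos; apply pow_le; lra).
  assert (0 <= m ^ S p * m ^ S p * (c * (m ^ p * m ^ p)))
    by (apply Rmult_le_pos; [easy|now apply Rmult_le_pos]).
  unfold K; lra. }
(* The factor of [idx_term_decay] that depends neither on the point nor on the order, so [N] below
   is uniform in [z]. *)
set (A := exp (2 * (beta * K) * INR (S p) ^ 2) * (INR (S p) * INR (Factorial.fact p) ^ 2)).
assert (HA : 0 < A).
{ apply Rmult_lt_0_compat; [apply exp_pos|apply Rmult_lt_0_compat].
  - apply lt_0_INR; lia.
  - apply pow_lt, INR_fact_lt_0. }
assert (Hib : 0 < / beta < 1).
{ split; [apply Rinv_0_lt_compat; lra|].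
  rewrite <- Rinv_1; apply Rinv_lt_contravar; lra. }
destruct (pow_lt_1_zero (/ beta) ltac:(rewrite Rabs_pos_eq; lra) (/ A)
  (Rinv_0_lt_compat _ HA)) as [N HN].
(* Orders above [N] decay enough to beat [A]; including [p] makes the maximum over orders at most
   [p] part of the final one. *)
exists (Nat.max N p); intros z Hz j k.
destruct (Nat.le_gt_cases (j + k) (Nat.max N p)) as [Hle|Hgt]; [now apply max_le_ge|].
destruct (HL z Hz) as [HL1 HL2]; destruct Hz as [Hz1 Hz2].
destruct (radius_lt (fst z) (l1 z) beta ltac:(lra) Hz1 HL1) as [P1 R1].
destruct (radius_lt (snd z) (l2 z) beta ltac:(lra) Hz2 HL2) as [P2 R2].
eapply Rle_trans.
{ apply (idx_term_decay F l1 l2 K beta p z); try easy; [lra|].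
  intros x y i i' Hx Hy Hi.
  pose proof (Cmod_shift x (fst z)); pose proof (Cmod_shift y (snd z)).
  assert (Hw : in_D2 (x, y)) by (split; simpl; lra).
  destruct (HL _ Hw) as [HL1' HL2']; pose proof Hw as [Hw1 Hw2].
  destruct (radius_lt x (l1 (x, y)) beta ltac:(lra) Hw1 HL1') as [P1' _].
  destruct (radius_lt y (l2 (x, y)) beta ltac:(lra) Hw2 HL2') as [P2' _].
  assert (Hpoly : in_polydisc l1 l2 beta beta z (x, y)) by now split.
  pose proof (conj Hz1 Hz2 : in_D2 z) as Hz.
  destruct (Hratio (l1 (x, y)) (l1 z) c1 M1) as [A1 B1]; auto; try lra.
  destruct (Hratio (l2 (x, y)) (l2 z) c2 M2) as [A2 B2]; auto; try lra.
  now apply (frozen_derivative_bound F l1 l2 (l1 z) (l2 z) m c p (x, y)); auto. }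
set (mu := max_le p (idx_term F l1 l2 z)).
assert (Hmu : 0 <= mu) by apply max_le_nonneg.
replace ((/ beta) ^ (j + k) * (exp (2 * (beta * K) * INR (S p) ^ 2) *
  (INR (S p) * (INR (Factorial.fact p) ^ 2 * mu)))) with ((/ beta) ^ (j + k) * A * mu)
  by (unfold A; ring).
apply Rle_trans with (1 * mu).
- apply Rmult_le_compat_r; [easy|].
  specialize (HN (j + k)%nat ltac:(lia)).
  rewrite Rabs_pos_eq in HN by (apply pow_le; lra).
  apply Rle_trans with (/ A * A); [apply Rmult_le_compat_r; lra|].
  rewrite Rinv_l; lra.
- rewrite Rmult_1_l; apply max_le_lub; [apply max_le_nonneg|]; intros i i' Hi.
  apply max_le_ge; lia.
Qed.

Theorem theorem6 (beta : R) (l1 l2 : C * C -> R) (F : C * C -> C) :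
  1 < beta ->
  admissible_L beta l1 l2 ->
  in_Q2 beta l1 l2 ->
  analytic_D2 F ->
  (bounded_L_index F l1 l2 <->
   exists (p : nat) (c : R), 0 <= c /\
     forall z, in_D2 z ->
       max_eq (S p) (nf_term F l1 l2 z) <= c * max_le p (nf_term F l1 l2 z)).
Proof.
intros Hbeta HL HQ HF; split.
- apply bounded_index_bounds_next_order; intros z Hz.
  destruct (proj2 HL z Hz) as [H1 H2]; destruct Hz as [Hz1 Hz2].
  split; [apply (radius_lt (fst z) _ beta)|
    apply (radius_lt (snd z) _ beta)]; lra.
- intros [p [c [Hc H]]].
  now apply (next_order_bound_bounds_index beta l1 l2 F p c).
Qed.
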